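(* Let $\alpha$ be a periodic orbit on an equilateral triangle $\triangle ABC$, let $\gamma$ be the Fagnano orbit, and let $O$ be a fixed point of $\overline{BC}$, other than its midpoint, that is nonsingular for every even class. Points are written in the rhombic coordinates with origin $O$. (1) If $\alpha$ has period $2n$, then the class $[\alpha]$ has cardinality $\mathfrak{c}$ (the cardinality of an interval) and contains exactly one representative whose unfolding $\underline{OS}$ satisfies $S=(x,y)$, $0\le x\le y$, $x\equiv y \pmod 3$, and $x+y=n$. (2) Otherwise, $\alpha=\gamma^{2k-1}$ for some integer $k\ge1$, in which case its period is $6k-3$.
   Context: Billiards. Let $R$ be the closed region bounded by the equilateral triangle $\triangle ABC$. A nonsingular trajectory is a piecewise linear constant (nonzero) speed curve $\alpha:\mathbb{R}\to R$, moving in straight lines between successive strikes on the sides, reflecting at each strike so that the angle of incidence equals the angle of reflection, and never reaching a vertex. It is periodic if $\alpha(a+t)=\alpha(b+t)$ for some $a<b$ and all $t$; its restriction to $[a,b]$ is a periodic orbit. A periodic orbit retraces the same path exactly $n\ge1$ times; if $n=1$ it is primitive, otherwise it is an $n$-fold iterate. If $\alpha$ is primitive, $\alpha^n$ is its $n$-fold iterate. The period is the number of strikes on the sides during the orbit (coinciding initial and final positions counted once). The Fagnano orbit $\gamma$ is the primitive orbit of period 3 traversing the triangle whose vertices are the midpoints of the sides. The angle of incidence at a strike is the (non-obtuse) angle between the path and the side struck. Periodic orbits are regarded as the same if they differ only by speed, choice of initial point, reversal of direction of travel, or a relabelling of the vertices (symmetry) of $\triangle ABC$. Unfoldings. Place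 $\triangle ABC$ with $\overline{BC}$ horizontal at the bottom, as a tile of a regular tessellation $\mathcal{T}$ of the plane by congruent equilateral triangles having one family of horizontal edges. Let $\alpha$ be a periodic orbit of period $n$. Every such orbit strikes a side at some point $P$ with angle of incidence in $[30^\circ,60^\circ]$; after relabelling vertices, changing the initial point and reversing the parameter if necessary, assume $P\in\overline{BC}$, $\alpha$ begins and ends at $P$, and both (Cartesian) components of the velocity on departure from $P$ are positive. Let $\alpha_1,\dots,\alpha_n$ be the successive directed segments of $\alpha$. Reflecting the triangle successively in the edges of $\mathcal{T}$ that the path meets, with reflections $\sigma_1,\dots,\sigma_{n-1}$ ($\sigma_1$ in the edge where $\alpha_1$ ends, $\sigma_2$ in the edge where $\sigma_1(\alpha_2)$ ends, etc.), the segments $\alpha_1,\sigma_1(\alpha_2),\dots,(\sigma_{n-1}\cdots\sigma_1)(\alpha_n)$ are collinear and their union is a directed segment $\underline{PQ}$ from $P$ to $Q=(\sigma_{n-1}\cdots\sigma_1)(P)$. Any directed segment so obtained is called an unfolding of $\alpha$. Equivalence. Periodic orbits $\alpha,\beta$ are equivalent if they have respective unfoldings $\underline{PQ}$, $\underline{RS}$ and there is a horizontal translation $\tau$ with $\underline{RS}=\tau(\underline{PQ})$. $[\alpha]$ denotes the equivalence class; its period is the period of its elements, and it is even if that period is even. The point $O$. If $[\alpha]$ is even with unfolding $\underline{PQ}$ and $R\in\overline{BC}$, then $R$ is singular for $[\alpha]$ if the translate of $\underline{PQ}$ by $\overrightarrow{PR}$ contains a vertex of $\mathcal{T}$, and nonsingular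 otherwise. A point $O$ of $\overline{BC}$ other than the midpoint that is nonsingular for every even class exists (there are countably many even classes, each with finitely many singular points); fix one. Rhombic coordinates: the origin is $O$, the $x$-axis is the horizontal line through $O$, the $y$-axis is the line through $O$ with inclination $60^\circ$, and $BC$ is the unit of length on both axes. *)

(* Defs.v *)
From HB Require Import structures.
From mathcomp Require Import all_boot all_order all_algebra perm.
From mathcomp Require Import all_classical all_reals all_analysis.

Set Implicit Arguments.
Unset Strict Implicit.
Unset Printing Implicit Defensive.

Import Order.TTheory GRing.Theory Num.Theory.
Import numFieldNormedType.Exports.

Local Open Scope classical_set_scope.
Local Open Scope ring_scope.

(* MathComp-Analysis.  The triangle has side length 1, with B at the Cartesian
   origin and BC along the positive horizontal axis. *)

Section Plane.
Variable R : realType.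

Definition plane := (R^o * R^o)%type.

Implicit Types (p q u v d : plane).

(* The library norm on a product is the sup norm, hence the explicit Euclidean
   structure. *)
Definition dot u v : R := u.1 * v.1 + u.2 * v.2.
Definition enorm u : R := Num.sqrt (dot u u).

Definition segment p q : set plane :=
  [set (1 - t) *: p + t *: q | t in `[0, 1]].

Definition reflect_dir d v : plane := (2 * dot v d / dot d d) *: d - v.

Definition reflect_line p q (r : plane) : plane :=
  p + reflect_dir (q - p) (r - p).

Definition line_angle u d : R := acos (`|dot u d| / (enorm u * enorm d)).

Definition e1 : plane := (1, 0).
Definition e2 : plane := (1 / 2, Num.sqrt 3 / 2).

Definition ptA : plane := e2.
Definition ptB : plane := 0.
Definition ptC : plane := e1.
Definition midpoint p q : plane := (1 / 2) *: (p + q).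

Definition vertex (i : 'I_3) : plane := nth ptA [:: ptA; ptB; ptC] i.

Definition triangle : set plane :=
  [set p | exists w : 'I_3 -> R,
     [/\ forall i, 0 <= w i, \sum_i w i = 1 & p = \sum_i w i *: vertex i]].

(* Side i is opposite to vertex i; indices are added modulo 3. *)
Definition side (i : 'I_3) : set plane :=
  segment (vertex (i + 1)) (vertex (i + 2%:R)).
Definition side_dir (i : 'I_3) : plane :=
  vertex (i + 2%:R) - vertex (i + 1).
Definition boundary : set plane := [set p | exists i, side i p].

Definition triangle_symmetry (g : plane -> plane) : Prop :=
  (forall p q, enorm (g p - g q) = enorm (p - q)) /\
  (exists s : {perm 'I_3}, forall i, g (vertex i) = vertex (s i)).

End Plane.

Arguments boundary {R}.
Arguments triangle {R}.
Arguments vertex {R}.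
Arguments side {R}.
Arguments side_dir {R}.
Arguments e1 {R}.
Arguments e2 {R}.
Arguments ptA {R}.
Arguments ptB {R}.
Arguments ptC {R}.

Section Billiards.
Variable R : realType.

Local Notation plane := (plane R).

Definition arrives (f : R -> plane) (t : R) (u : plane) : Prop :=
  exists2 e : R, 0 < e & forall s, 0 <= s <= e -> f (t - s) = f t - s *: u.

Definition departs (f : R -> plane) (t : R) (v : plane) : Prop :=
  exists2 e : R, 0 < e & forall s, 0 <= s <= e -> f (t + s) = f t + s *: v.

(* Local form: near every time the curve is straight on each side of that time,
   and its direction changes only at a strike, by the law of reflection.  By
   compactness of time intervals such a curve is piecewise linear.  A curve
   running along a side would reach a vertex, so it is excluded. *)
Definition nonsingular_trajectory (f : R -> plane) : Prop :=
  exists2 c : R, 0 < c &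
  forall t : R,
    [/\ triangle (f t),
        forall i, f t <> vertex i &
        exists u v : plane,
          [/\ arrives f t u, departs f t v, enorm u = c /\ enorm v = c,
              ~ boundary (f t) -> v = u &
              forall i, side i (f t) -> v = reflect_dir (side_dir i) u]].

(* A trajectory together with the time interval on which it is considered. *)
Record billiard_orbit :=
  BilliardOrbit { traj : R -> plane; start : R; stop : R }.

Implicit Types a b : billiard_orbit.

Definition periodic_orbit a : Prop :=
  [/\ nonsingular_trajectory (traj a), start a < stop a &
      forall t, traj a (start a + t) = traj a (stop a + t)].

Definition primitive a : Prop :=
  periodic_orbit a /\
  ~ exists c, start a < c < stop a /\
      forall t, traj a (start a + t) = traj a (c + t).

Definition iterate a (n : nat) : billiard_orbit :=
  BilliardOrbit (traj a) (start a) (start a + n%:R * (stop a - start a)).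

(* The final time is left out, so that the coinciding initial and final
   positions are counted once. *)
Definition strike_times a : set R :=
  [set t | start a <= t < stop a /\ boundary (traj a t)].

Definition has_period a (n : nat) : Prop := (strike_times a #= `I_n)%card.

Definition even_period a : Prop := exists n, has_period a (2 * n)%N.

(* t |-> c * t + d changes the speed, the initial point and, if c < 0, the
   direction of travel; g relabels the vertices. *)
Definition same_orbit a b : Prop :=
  exists (g : plane -> plane) (c d : R),
    [/\ triangle_symmetry g, c != 0,
        forall t, traj b t = g (traj a (c * t + d)) &
        `|c| * (stop b - start b) = stop a - start a].

Definition fagnano a : Prop :=
  [/\ primitive a, has_period a 3 &
      [set traj a t | t in `[start a, stop a]] =
        segment (midpoint ptA ptB) (midpoint ptB ptC)
        `|` segment (midpoint ptB ptC) (midpoint ptC ptA)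
        `|` segment (midpoint ptC ptA) (midpoint ptA ptB)].

Definition tess_vertex (p : plane) : Prop :=
  exists i j : int, p = i%:~R *: e1 + j%:~R *: e2.

Definition tess_edge (p q : plane) : Prop :=
  [/\ tess_vertex p, tess_vertex q & enorm (p - q) = 1].

(* The orbit begins at a strike on BC with angle of incidence between 30 and 60
   degrees, and leaves up and to the right. *)
Definition normalized a : Prop :=
  segment ptB ptC (traj a (start a)) /\
  exists u v : plane,
    [/\ arrives (traj a) (start a) u, departs (traj a) (start a) v,
        pi / 6 <= line_angle u (ptC - ptB) <= pi / 3 & 0 < v.1 /\ 0 < v.2].

Definition successive_strikes a (n : nat) (s : nat -> R) : Prop :=
  [/\ s 0%N = start a, s n = stop a,
      forall i, (i < n)%N -> s i < s i.+1,
      forall i, (i <= n)%N -> boundary (traj a (s i)) &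
      forall i t, (i < n)%N -> s i < t < s i.+1 -> ~ boundary (traj a t)].

(* compose sigma k = sigma k \o ... \o sigma 1; the value sigma 0 is unused. *)
Fixpoint compose (sigma : nat -> plane -> plane) (k : nat) : plane -> plane :=
  if k is k'.+1 then sigma k \o compose sigma k' else id.

Definition edge_reflections a (n : nat) (s : nat -> R)
    (sigma : nat -> plane -> plane) : Prop :=
  forall i, (0 < i < n)%N ->
    exists p q : plane,
      [/\ tess_edge p q, segment p q (compose sigma i.-1 (traj a (s i))) &
          sigma i = reflect_line p q].

(* The directed segment PQ is an unfolding of a.  Different choices of the
   initial point P, the labelling and the direction of travel may give several
   unfoldings. *)
Definition unfolding a (P Q : plane) : Prop :=
  exists (a' : billiard_orbit) (n : nat) (s : nat -> R)
         (sigma : nat -> plane -> plane),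
    [/\ same_orbit a a' /\ normalized a', successive_strikes a' n s,
        edge_reflections a' n s sigma, P = traj a' (start a') &
        Q = compose sigma n.-1 P].

Definition equivalent a b : Prop :=
  exists P Q R' S : plane,
    [/\ unfolding a P Q, unfolding b R' S &
        exists h : R, R' = P + h *: e1 /\ S = Q + h *: e1].

(* The class of a, as a set of parametrized orbits. *)
Definition eq_class a : set billiard_orbit :=
  [set b | periodic_orbit b /\ equivalent a b].

Definition same_class b : set billiard_orbit :=
  [set b' | periodic_orbit b' /\ same_orbit b b'].

(* The class of a with orbits regarded as the same identified: each element is
   the set of all parametrizations of one orbit. *)
Definition eq_class_mod_same a : set (set billiard_orbit) :=
  same_class @` eq_class a.

Definition singular_point a (R' : plane) : Prop :=
  exists (b : billiard_orbit) (P Q : plane),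
    [/\ eq_class a b, unfolding b P Q, segment ptB ptC R' &
        exists2 p, tess_vertex p & segment R' (Q + (R' - P)) p].

Definition rhombic (O : plane) (x y : R) : plane := O + x *: e1 + y *: e2.

Definition standard_representative (O : plane) (n : nat) b : Prop :=
  exists (S : plane) (x y : int),
    [/\ unfolding b O S, S = rhombic O x%:~R y%:~R, 0 <= x <= y,
        (x = y %[mod 3])%Z & x + y = n%:Z].

End Billiards.

(* Main.v *)
Require Import Defs.
From mathcomp Require Import all_boot all_order all_algebra perm ring lra zify.
From mathcomp Require Import all_classical all_reals all_analysis.
Import Order.TTheory GRing.Theory Num.Theory.
Import numFieldNormedType.Exports.
Local Open Scope classical_set_scope.
Local Open Scope ring_scope.
Set Implicit Arguments.
Unset Strict Implicit.
Unset Printing Implicit Defensive.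

(** A billiard path in the triangle unfolds to a straight line, and conversely the
    path is recovered from the line by folding the plane onto the triangle, that
    is, by taking the quotient by the group generated by the reflections in the
    edges of the tessellation, for which the triangle is a fundamental domain
    ([triangle_weyl_eq]).  [nonsingular_folds] and [folds_nonsingular] make this
    precise: trajectories are exactly the foldings of lines that miss all
    vertices, and the line is unique up to the group ([folds_change]).

    All symmetries of the tessellation are compositions of such reflections with
    relabellings of the triangle, so every periodic orbit is, up to the
    identification of orbits, the folding of a segment from P on BC to P + V with
    V of inclination between 30 and 60 degrees ([normalize]); and the unfoldings
    of the orbit are exactly these segments ([unfolding_line],
    [sector_line_unfolding]).

    Closing up means that an element of the group carries (P, V) to (P + V, V)
    ([line_orbit_periodic]).  By [periodic_line_cases] it is either a translation,
    and then V = (x, y) is a lattice vector with x = y modulo 3, or a glide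
    reflection, and then P is the midpoint of BC and V = (0, 3 m / 2) with m odd.
    Counting the lines crossed, the period is 2 (x + y) in the first case and 3 m
    in the second ([even_count], [odd_count]).  Hence orbits of odd period all run along the
    path of the Fagnano orbit, m times.

    In the even case V does not depend on the unfolding: the period determines
    x + y, and the length determines x^2 + x y + y^2 ([even_vector_unique]).  A
    class is therefore given by V, and its members by their starting points on
    BC.  The point O is the starting point of exactly one member.  Only finitely
    many starting points give the same orbit; [start_congruence] and
    [even_class_card] exhibit an interval of them that give different ones. *)

(** * Rhombic coordinates *)

Section Coordinates.
Variable R : realType.
Local Notation plane := (plane R).
Implicit Types (p q r u v d : plane) (i : 'I_3) (k m n : int).

(** (rx p, ry p) are the coordinates of p in the basis (e1, e2): the vertices of
    the tessellation are the points where both are integers, and its lines are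
    those where rx, ry or rx + ry is an integer constant. *)
Definition rx p : R := p.1 - p.2 / Num.sqrt 3.
Definition ry p : R := 2 * p.2 / Num.sqrt 3.

Lemma sqrt3_gt0 : 0 < Num.sqrt 3 :> R.
Proof. by rewrite sqrtr_gt0. Qed.

Lemma sqrt3_sq : Num.sqrt 3 ^+ 2 = 3 :> R.
Proof. by rewrite sqr_sqrtr. Qed.

Lemma rxD p q : rx (p + q) = rx p + rx q.
Proof. rewrite /rx /=. by ring. Qed.
Lemma ryD p q : ry (p + q) = ry p + ry q.
Proof. rewrite /ry /=. by ring. Qed.
Lemma rxN p : rx (- p) = - rx p.
Proof. rewrite /rx /=. by ring. Qed.
Lemma ryN p : ry (- p) = - ry p.
Proof. rewrite /ry /=. by ring. Qed.
Lemma rxZ (c : R) p : rx (c *: p) = c * rx p.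
Proof. rewrite /rx /= /GRing.scale /=. by ring. Qed.
Lemma ryZ (c : R) p : ry (c *: p) = c * ry p.
Proof. rewrite /ry /= /GRing.scale /=. by ring. Qed.
Lemma rx0 : rx 0 = 0.
Proof. by rewrite /rx /= mul0r subr0. Qed.
Lemma ry0 : ry 0 = 0.
Proof. by rewrite /ry /= mulr0 mul0r. Qed.
Lemma rx_e1 : rx e1 = 1.
Proof. by rewrite /rx /= mul0r subr0. Qed.
Lemma ry_e1 : ry e1 = 0.
Proof. by rewrite /ry /= mulr0 mul0r. Qed.
Lemma rx_e2 : rx e2 = 0.
Proof. rewrite /rx /=. have := sqrt3_gt0. move=> h. field. by lra. Qed.
Lemma ry_e2 : ry e2 = 1.
Proof. rewrite /ry /=. have := sqrt3_gt0. move=> h. field. by lra. Qed.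

Definition rxyE := (rxD, ryD, rxN, ryN, rxZ, ryZ, rx0, ry0, rx_e1, ry_e1, rx_e2, ry_e2).

Lemma rxy_inj p q : rx p = rx q -> ry p = ry q -> p = q.
Proof.
have s0 := sqrt3_gt0; have nz : Num.sqrt 3 != 0 :> R by rewrite gt_eqF.
have K2 (x : R) : x = 2 * x / Num.sqrt 3 * (Num.sqrt 3 / 2) by field.
case: p q => [a b] [c d]; rewrite /rx /ry /= => h1 h2.
have bd : b = d by rewrite (K2 b) h2; apply/esym/K2.
by move: h1; rewrite bd => /addIr ->.
Qed.

Lemma rx_rhombic p (x y : R) : rx (rhombic p x y) = rx p + x.
Proof. rewrite /rhombic !rxyE. by ring. Qed.
Lemma ry_rhombic p (x y : R) : ry (rhombic p x y) = ry p + y.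
Proof. rewrite /rhombic !rxyE. by ring. Qed.

(** The Gram matrix of (e1, e2) has 1 on the diagonal and 1/2 off it. *)
Lemma dot_rxyE p q :
  dot p q = rx p * rx q + ry p * ry q + (rx p * ry q + ry p * rx q) / 2.
Proof.
have s0 := sqrt3_gt0; have nz : Num.sqrt 3 != 0 :> R by rewrite gt_eqF.
have aux (a b c d s : R) : s != 0 -> s ^+ 2 = 3 ->
    a * c + b * d = (a - b / s) * (c - d / s) + 2 * b / s * (2 * d / s) +
      ((a - b / s) * (2 * d / s) + 2 * b / s * (c - d / s)) / 2.
  move=> sn s3; have -> : b * d = b * d * 3 / s ^+ 2 by rewrite s3; field.
  by field.
exact: aux nz sqrt3_sq.
Qed.

Lemma tess_vertexP p :
  tess_vertex p <-> exists i j : int, rx p = i%:~R /\ ry p = j%:~R.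
Proof.
split=> [[i [j ->]]|[i [j [hi hj]]]].
  by exists i, j; rewrite !rxyE; split; ring.
by exists i, j; apply: rxy_inj; rewrite !rxyE ?hi ?hj; ring.
Qed.

(** Barycentric coordinates with respect to A, B, C, in this order. *)
Definition bary i p : R := nth 0 [:: ry p; 1 - rx p - ry p; rx p] i.

Lemma big3 (V : zmodType) (F : 'I_3 -> V) :
  \sum_i F i = F 0 + F 1 + F 2%:R.
Proof.
rewrite !big_ord_recr big_ord0 /= add0r.
by congr (F _ + F _ + F _); apply: val_inj.
Qed.

Lemma bary_sum p : \sum_i bary i p = 1.
Proof. rewrite big3 /bary /=. by ring. Qed.

Lemma vertex0 : vertex 0 = e2 :> plane. Proof. by []. Qed.
Lemma vertex1 : vertex 1 = 0 :> plane. Proof. by []. Qed.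
Lemma vertex2 : vertex 2%:R = e1 :> plane. Proof. by []. Qed.

Lemma baryK p : \sum_i bary i p *: vertex i = p.
Proof.
rewrite big3 vertex0 vertex1 vertex2 /bary /=.
by apply: rxy_inj; rewrite !rxyE; ring.
Qed.

Lemma bary_comb (w : 'I_3 -> R) i :
  \sum_j w j = 1 -> bary i (\sum_j w j *: vertex j) = w i.
Proof.
rewrite !big3 vertex0 vertex1 vertex2 => h.
case: i => [[|[|[|//]]] hi]; rewrite /bary /= !rxyE.
- transitivity (w 0); last by congr w; apply: val_inj.
  by ring.
- transitivity (w 1); last by congr w; apply: val_inj.
  by lra.
- transitivity (w 2%:R); last by congr w; apply: val_inj.
  by ring.
Qed.

Lemma bary_inj p q : (forall i, bary i p = bary i q) -> p = q.
Proof. by move=> h; rewrite -(baryK p) -(baryK q); apply: eq_bigr => i _; rewrite h. Qed.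

Lemma triangleP p : triangle p <-> forall i, 0 <= bary i p.
Proof.
split=> [[w [w0 w1 ->]] i|h]; first by rewrite bary_comb.
exists (fun i => bary i p); split=> //; first exact: bary_sum.
by rewrite baryK.
Qed.

Lemma triangle_rxyP p : triangle p <-> [/\ 0 <= rx p, 0 <= ry p & rx p + ry p <= 1].
Proof.
rewrite triangleP; split=> [h|[h1 h2 h3] [[|[|[|//]]] hi]]; rewrite /bary /=; last 3 first.
- by []. - by lra. - by [].
have := (h 0, h 1, h 2%:R); rewrite /bary /= => -[[h0 h1] h2].
split=> //; by lra.
Qed.

Lemma ord3_cases (P : 'I_3 -> Prop) : P 0 -> P 1 -> P 2%:R -> forall i, P i.
Proof.
move=> h0 h1 h2 [[|[|[|//]]] hi].
- by rewrite (_ : Ordinal hi = 0) //; apply: val_inj.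
- by rewrite (_ : Ordinal hi = 1) //; apply: val_inj.
- by rewrite (_ : Ordinal hi = 2%:R) //; apply: val_inj.
Qed.

Lemma segmentP p q r : segment p q r <->
  exists2 t : R, 0 <= t <= 1 & r = p + t *: (q - p).
Proof.
split=> -[t]; rewrite /= ?in_itv /= => ht.
  by move=> <-; exists t => //; apply: rxy_inj; rewrite !rxyE; ring.
by move=> ->; exists t; rewrite /= ?in_itv //=; apply: rxy_inj; rewrite !rxyE; ring.
Qed.

Lemma ord3E : (((0 + 1)%R = 1%R :> 'I_3) *
   ((0 + 2%:R)%R = 2%:R :> 'I_3) *
   ((1 + 1)%R = 2%:R :> 'I_3) *
   ((1 + 2%:R)%R = 0%R :> 'I_3) *
   ((2%:R + 1)%R = 0%R :> 'I_3) *
   ((2%:R + 2%:R)%R = 1%R :> 'I_3))%type.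
Proof. by do !split; apply: val_inj. Qed.

Lemma sideP i p : side i p <-> triangle p /\ bary i p = 0.
Proof.
rewrite triangle_rxyP /side segmentP.
elim/ord3_cases: i; rewrite !ord3E ?vertex0 ?vertex1 ?vertex2 /bary /=.
- split=> [[t /andP[t0 t1] ->]|[[h1 h2 h3] h4]].
    by rewrite !rxyE; split; [split|]; lra.
  exists (rx p); first by lra. by apply: rxy_inj; rewrite !rxyE; lra.
- split=> [[t /andP[t0 t1] ->]|[[h1 h2 h3] h4]].
    by rewrite !rxyE; split; [split|]; lra.
  exists (ry p); first by lra. by apply: rxy_inj; rewrite !rxyE; lra.
- split=> [[t /andP[t0 t1] ->]|[[h1 h2 h3] h4]].
    by rewrite !rxyE; split; [split|]; lra.
  exists (1 - ry p); first by lra. by apply: rxy_inj; rewrite !rxyE; lra.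
Qed.

End Coordinates.

(** * Plane motions and the mirrors of the tessellation *)

Section Motions.
Variable R : realType.
Local Notation plane := (plane R).
Implicit Types (p q r u v d : plane) (i : 'I_3) (h : plane -> plane).

Definition lin h v : plane := h v - h 0.

(** Affine isometries, with affinity stated along lines. *)
Definition motion h : Prop :=
  (forall p v (s : R), h (p + s *: v) = h p + s *: lin h v) /\
  (forall u v, dot (lin h u) (lin h v) = dot u v).

Lemma motionD h p v : motion h -> h (p + v) = h p + lin h v.
Proof. by case=> h1 _; have := h1 p v 1; rewrite !scale1r. Qed.

Lemma linD h u v : motion h -> lin h (u + v) = lin h u + lin h v.
Proof. by move=> mh; rewrite {1}/lin motionD // addrAC. Qed.

Lemma linZ h (c : R) v : motion h -> lin h (c *: v) = c *: lin h v.
Proof.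
case=> h1 _; have := h1 0 v c; rewrite add0r => e.
by rewrite {1}/lin e addrAC subrr add0r.
Qed.

Lemma linB h p q : motion h -> lin h (p - q) = h p - h q.
Proof.
move=> mh; have -> : h p = h q + lin h (p - q) by rewrite -motionD // addrC subrK.
by rewrite addrAC subrr add0r.
Qed.

Lemma linN h v : motion h -> lin h (- v) = - lin h v.
Proof. by move=> mh; rewrite -scaleN1r linZ // scaleN1r. Qed.

Lemma motion_id : motion id.
Proof. by split=> *; rewrite /lin !subr0. Qed.

Lemma lin_id v : lin id v = v.
Proof. by rewrite /lin subr0. Qed.

Lemma lin_comp h1 h2 v : motion h1 -> lin (h1 \o h2) v = lin h1 (lin h2 v).
Proof. by move=> m1; rewrite /lin /= -[RHS]/(lin h1 _) linB. Qed.

Lemma motion_comp h1 h2 : motion h1 -> motion h2 -> motion (h1 \o h2).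
Proof.
move=> m1 m2; split=> [p v s|u v].
  by rewrite (lin_comp h2 v m1) /comp (m2.1 p v s) (m1.1 (h2 p) (lin h2 v) s).
by rewrite (lin_comp h2 u m1) (lin_comp h2 v m1) (m1.2 (lin h2 u)) (m2.2 u v).
Qed.

Lemma dotDl u v r : dot (u + v) r = dot u r + dot v r.
Proof. rewrite !dot_rxyE !rxyE. by lra. Qed.
Lemma dotZl (c : R) v r : dot (c *: v) r = c * dot v r.
Proof. rewrite !dot_rxyE !rxyE. by lra. Qed.
Lemma dotC u v : dot u v = dot v u.
Proof. rewrite !dot_rxyE. by lra. Qed.
Lemma dotDr r u v : dot r (u + v) = dot r u + dot r v.
Proof. by rewrite dotC dotDl !(dotC r). Qed.
Lemma dotZr (c : R) r v : dot r (c *: v) = c * dot r v.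
Proof. by rewrite dotC dotZl !(dotC r). Qed.
Lemma dotNl v r : dot (- v) r = - dot v r.
Proof. by rewrite -scaleN1r dotZl mulN1r. Qed.
Lemma dotNr r v : dot r (- v) = - dot r v.
Proof. by rewrite dotC dotNl dotC. Qed.

Lemma dot_ge0 v : 0 <= dot v v.
Proof. rewrite /dot. by apply: addr_ge0; rewrite -expr2 sqr_ge0. Qed.

Lemma dot_eq0 v : (dot v v == 0) = (v == 0).
Proof.
rewrite /dot -!expr2 paddr_eq0 ?sqr_ge0 // !sqrf_eq0.
by case: v => a b.
Qed.

Lemma dot_gt0 v : v <> 0 -> 0 < dot v v.
Proof. by move=> /eqP; rewrite -dot_eq0 lt0r dot_ge0 andbT. Qed.

Lemma enorm_lin h v : motion h -> enorm (lin h v) = enorm v.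
Proof. by case=> _ mh; rewrite /enorm mh. Qed.

Lemma enorm_motion h p q : motion h -> enorm (h p - h q) = enorm (p - q).
Proof. by move=> mh; rewrite -linB // enorm_lin. Qed.

Lemma enormZ (c : R) v : enorm (c *: v) = `|c| * enorm v.
Proof.
by rewrite /enorm dotZl dotZr mulrA -expr2 sqrtrM ?sqr_ge0 // sqrtr_sqr.
Qed.

Lemma enorm_gt0 v : v <> 0 -> 0 < enorm v.
Proof. by move=> v0; rewrite sqrtr_gt0 dot_gt0. Qed.

Lemma enorm_sq v : enorm v ^+ 2 = dot v v.
Proof. by rewrite sqr_sqrtr ?dot_ge0. Qed.

Lemma lin_neq0 h v : motion h -> v <> 0 -> lin h v <> 0.
Proof.
move=> mh v0 /eqP; rewrite -dot_eq0 (mh.2) dot_eq0 => /eqP; exact: v0.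
Qed.

Lemma reflect_dirD d u v : reflect_dir d (u + v) = reflect_dir d u + reflect_dir d v.
Proof. by rewrite /reflect_dir dotDl !mulrDr mulrDl scalerDl opprD addrACA. Qed.
Lemma reflect_dirZ d (c : R) v : reflect_dir d (c *: v) = c *: reflect_dir d v.
Proof. by rewrite /reflect_dir dotZl scalerBr scalerA mulrCA !mulrA. Qed.
Lemma reflect_dirN d v : reflect_dir d (- v) = - reflect_dir d v.
Proof. by rewrite -scaleN1r reflect_dirZ scaleN1r. Qed.
Lemma reflect_dir_degenerate v : reflect_dir 0 v = - v.
Proof. by apply: rxy_inj; rewrite /reflect_dir !rxyE mulr0 add0r. Qed.

Lemma reflect_dir_dot d u v : dot (reflect_dir d u) (reflect_dir d v) = dot u v.
Proof.
have [->|d0] := eqVneq d 0.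
  by rewrite !reflect_dir_degenerate dotNl dotNr opprK.
rewrite /reflect_dir !(dotDl, dotDr, dotZl, dotZr, dotNl, dotNr) !(dotC d).
move: d0; rewrite -dot_eq0 => d0; by field.
Qed.

Lemma reflect_dirK d : involutive (reflect_dir d).
Proof.
move=> v; have [->|d0] := eqVneq d 0.
  by rewrite !reflect_dir_degenerate opprK.
rewrite {2}/reflect_dir reflect_dirD reflect_dirZ reflect_dirN.
have -> : reflect_dir d d = d.
  rewrite /reflect_dir; move: d0; rewrite -dot_eq0 => d0.
  by rewrite mulfK // scaler_nat mulr2n addrK.
by rewrite /reflect_dir opprB addrCA subrr addr0.
Qed.

Lemma reflect_line_lin p q v : lin (reflect_line p q) v = reflect_dir (q - p) v.
Proof.
rewrite /lin /reflect_line.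
have -> : v - p = v + (0 - p) by rewrite sub0r.
by rewrite reflect_dirD opprD addrACA subrr add0r addrK.
Qed.

Lemma motion_reflect p q : motion (reflect_line p q).
Proof.
split=> [r v s|u v]; rewrite !reflect_line_lin ?reflect_dir_dot //.
by rewrite /reflect_line -reflect_dirZ (addrAC r) (reflect_dirD _ (r - p)) addrA.
Qed.

Lemma reflect_lineK p q : involutive (reflect_line p q).
Proof.
move=> r; rewrite /reflect_line (addrC p (reflect_dir _ (r - p))) addrK reflect_dirK.
by rewrite (addrC p (r - p)) subrK.
Qed.

Lemma lin_reflect_dir h d v : motion h ->
  lin h (reflect_dir d v) = reflect_dir (lin h d) (lin h v).
Proof.
move=> mh; rewrite /reflect_dir (mh.2 v d) (mh.2 d d).
by rewrite (linD _ (- v) mh) (linN _ mh) (linZ _ _ mh).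
Qed.

(** Reflections are conjugated to reflections by motions.  This is why the group
    generated by the reflections is normalized by every symmetry of the
    tessellation, and why unfolding tile by tile gives a straight path. *)
Lemma reflect_line_motion h p q r : motion h ->
  h (reflect_line p q r) = reflect_line (h p) (h q) (h r).
Proof.
move=> mh; rewrite {1}/reflect_line (motionD _ _ mh) lin_reflect_dir //.
by rewrite (linB _ _ mh) (linB _ _ mh).
Qed.

Lemma segment_motion h p q r : motion h ->
  segment p q r -> segment (h p) (h q) (h r).
Proof.
move=> mh /segmentP[t t01 ->]; apply/segmentP; exists t => //.
by rewrite (mh.1) linB.
Qed.

Definition tess_map h : Prop := forall p, tess_vertex p -> tess_vertex (h p).

Lemma tess_edge_motion h p q : motion h -> tess_map h ->
  tess_edge p q -> tess_edge (h p) (h q).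
Proof. by move=> mh th [tp tq e]; split; [exact: th|exact: th|rewrite enorm_motion]. Qed.

(** The functional wall i vanishes on the direction of side i, so that the lines
    of the tessellation are the sets where some wall i is an integer; wdir i is
    normal to these lines, scaled so that the mirror below is a reflection. *)
Definition wall i p : R := nth 0 [:: ry p; rx p + ry p; rx p] i.
Definition wdir i : plane :=
  nth 0 [:: rhombic 0 1 (-2); rhombic 0 (-1) (-1); rhombic 0 (-2) 1] i.
Definition mirror i (k : int) p : plane := p + (wall i p - k%:~R) *: wdir i.

Lemma mirrorE i (k : int) p :
  (rx (mirror i k p) = rx p + (wall i p - k%:~R) * nth 0 [:: 1; -1; -2] i) *
  (ry (mirror i k p) = ry p + (wall i p - k%:~R) * nth 0 [:: -2; -1; 1] i).
Proof.
rewrite /mirror !rxyE; elim/ord3_cases: i; rewrite /wall /wdir /= ?(rx_rhombic, ry_rhombic) ?rxyE.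
- by split; lra.
- by split; lra.
- by split; lra.
Qed.

(** A unit vector on which wall i vanishes is determined up to sign, and a
    reflection depends on its line only. *)
Lemma reflect_line_mirror p q i (k : int) :
  dot (q - p) (q - p) = 1 -> wall i p = k%:~R -> wall i q = k%:~R ->
  reflect_line p q =1 mirror i k.
Proof.
move=> d1 hp hq r; rewrite /reflect_line /reflect_dir d1 divr1.
have sq1 (x : R) : x * x = 1 -> x = 1 \/ x = -1.
  by move/eqP; rewrite -expr2 sqrf_eq1 => /orP[]/eqP; [left|right].
have E (D v : plane) : p + ((2 * dot v D) *: D - v) = rhombic 0
    (rx p + (2 * dot v D * rx D - rx v)) (ry p + (2 * dot v D * ry D - ry v)).
  by apply: rxy_inj; rewrite ?(rx_rhombic, ry_rhombic) !rxyE add0r.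
rewrite E !dot_rxyE; apply: rxy_inj; rewrite mirrorE ?(rx_rhombic, ry_rhombic) ?rx0 ?ry0 add0r.
all: move: d1; rewrite dot_rxyE; have rD : rx r - rx p = rx (r - p) :> R by rewrite !rxyE.
all: have rD' : ry r - ry p = ry (r - p) :> R by rewrite !rxyE.
all: have D1 : rx q - rx p = rx (q - p) :> R by rewrite !rxyE.
all: have D2 : ry q - ry p = ry (q - p) :> R by rewrite !rxyE.
(* (dx, dy) is a unit vector on the line, so one of its coordinates is 1 or -1. *)
all: move: (rx (q - p)) (ry (q - p)) (rx (r - p)) (ry (r - p)) D1 D2 rD rD'
  => dx dy X Y D1 D2 rD rD' d1.
all: move: hp hq; elim/ord3_cases: i; rewrite /wall /= => hp hq.
- have dy0 : dy = 0 by lra.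
  have /sq1 : dx * dx = 1 :> R by move: d1; rewrite dy0; lra.
  by case=> e; rewrite dy0 e; lra.
- have dy0 : dy = - dx by lra.
  have /sq1 : dx * dx = 1 :> R by move: d1; rewrite dy0; lra.
  by case=> e; rewrite dy0 e; lra.
- have dx0 : dx = 0 by lra.
  have /sq1 : dy * dy = 1 :> R by move: d1; rewrite dx0; lra.
  by case=> e; rewrite dx0 e; lra.
- have dy0 : dy = 0 by lra.
  have /sq1 : dx * dx = 1 :> R by move: d1; rewrite dy0; lra.
  by case=> e; rewrite dy0 e; lra.
- have dy0 : dy = - dx by lra.
  have /sq1 : dx * dx = 1 :> R by move: d1; rewrite dy0; lra.
  by case=> e; rewrite dy0 e; lra.
- have dx0 : dx = 0 by lra.
  have /sq1 : dy * dy = 1 :> R by move: d1; rewrite dx0; lra.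
  by case=> e; rewrite dx0 e; lra.
Qed.

(** A lattice vector of length 1 satisfies x^2 + x y + y^2 = 1 in integers, hence
    x = 0, y = 0 or x + y = 0: every edge lies on a line of the tessellation. *)
Lemma tess_edge_mirror p q : tess_edge p q -> exists i (k : int),
  [/\ wall i p = k%:~R, wall i q = k%:~R & reflect_line p q =1 mirror i k].
Proof.
case=> /tess_vertexP[a [b [pa pb]]] /tess_vertexP[c [d [qc qd]]] e.
have d1 : dot (p - q) (p - q) = 1 by rewrite -enorm_sq e expr1n.
have d1' : dot (q - p) (q - p) = 1 by rewrite -opprB dotNl dotNr opprK.
have e1 : (a - c) * (a - c) + (b - d) * (b - d) + (a - c) * (b - d) = 1 :> int.
  move: d1; rewrite dot_rxyE !rxyE pa pb qc qd => h; apply: (@intr_inj R).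
  rewrite !(intrD, intrM, intrN, intrB). by lra.
have {e1} : [\/ b = d, a = c | a + b = c + d].
  set x := a - c; set y := b - d; rewrite -/x -/y in e1.
  have hx : -1 <= x <= 1 by nia.
  have hy : -1 <= y <= 1 by nia.
  have [x1|[x1|x1]] : x = -1 \/ x = 0 \/ x = 1 by lia.
  - have [y1|[y1|y1]] : y = -1 \/ y = 0 \/ y = 1 by lia.
    + by rewrite x1 y1 in e1.
    + by constructor 1; lia.
    + by constructor 3; lia.
  - by constructor 2; lia.
  - have [y1|[y1|y1]] : y = -1 \/ y = 0 \/ y = 1 by lia.
    + by constructor 3; lia.
    + by constructor 1; lia.
    + by rewrite x1 y1 in e1.
move=> H.
have [i [k [hp hq]]] : exists i (k : int), wall i p = k%:~R /\ wall i q = k%:~R.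
  case: H => h.
  - by exists 0, b; rewrite /wall /= pb qd h.
  - by exists 2%:R, a; rewrite /wall /= pa qc h.
  - by exists 1, (a + b); rewrite /wall /= pa pb qc qd -!intrD h.
by exists i, k; split=> //; apply: reflect_line_mirror.
Qed.

Lemma mirror_edge i (k : int) : exists p q,
  tess_edge p q /\ reflect_line p q =1 mirror i k.
Proof.
suff [a [b [c [d [e h1 h2]]]]] : exists a b c d : int,
    [/\ (a - c) * (a - c) + (b - d) * (b - d) + (a - c) * (b - d) = 1 :> int,
      nth 0 [:: b; a + b; a] i = k & nth 0 [:: d; c + d; c] i = k].
  pose p := rhombic (0 : plane) a%:~R b%:~R; pose q := rhombic (0 : plane) c%:~R d%:~R.
  have [pa pb] : rx p = a%:~R /\ ry p = b%:~R by rewrite rx_rhombic ry_rhombic !rxyE !add0r.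
  have [qc qd] : rx q = c%:~R /\ ry q = d%:~R by rewrite rx_rhombic ry_rhombic !rxyE !add0r.
  clearbody p q.
  have d1 : dot (p - q) (p - q) = 1.
    move: e => /(congr1 (fun z : int => z%:~R : R)); rewrite !(intrD, intrM, intrN, intrB).
    rewrite dot_rxyE !rxyE pa pb qc qd => h. by lra.
  have d1' : dot (q - p) (q - p) = 1 by rewrite -opprB dotNl dotNr opprK.
  have wE r (x y : int) : rx r = x%:~R -> ry r = y%:~R ->
      wall i r = (nth 0 [:: y; x + y; x] i)%:~R.
    move=> rx_ ry_; elim/ord3_cases: i {h1 h2}; by rewrite /wall /= ?rx_ ?ry_ ?intrD.
  have hp : wall i p = k%:~R by rewrite (wE _ _ _ pa pb) h1.
  have hq : wall i q = k%:~R by rewrite (wE _ _ _ qc qd) h2.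
  exists p, q; split=> //; last exact: reflect_line_mirror.
  split; [by apply/tess_vertexP; exists a, b|by apply/tess_vertexP; exists c, d|].
  by rewrite /enorm d1 sqrtr1.
elim/ord3_cases: i.
- by exists 0, k, 1, k; rewrite /=; split=> //; lia.
- by exists k, 0, (k - 1), 1; rewrite /=; split=> //; lia.
- by exists k, 0, k, 1; rewrite /=; split=> //; lia.
Qed.
End Motions.

(** * The affine Weyl group generated by the edges *)

Section Weyl.
Variable R : realType.
Local Notation plane := (plane R).
Implicit Types (p q r u v d : plane) (i : 'I_3) (h w g : plane -> plane).

(** The affine Weyl group of type A2, acting simply transitively on the tiles.
    Its elements relate a billiard path to its unfolding. *)
Inductive weyl : (plane -> plane) -> Prop :=
| weyl_id : weyl id
| weyl_reflect p q w : tess_edge p q -> weyl w -> weyl (reflect_line p q \o w).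

Lemma weyl_motion w : weyl w -> motion w.
Proof.
by elim=> [|p q {}w _ _ mw]; [exact: motion_id|exact/motion_comp/mw/motion_reflect].
Qed.

Lemma mirror_tess i (k : int) : tess_map (@mirror R i k).
Proof.
move=> r /tess_vertexP[a [b [ra rb]]]; apply/tess_vertexP; rewrite /mirror.
elim/ord3_cases: i; rewrite /wall /wdir /=.
- exists (a + b - k), (2 * k - b).
  by rewrite !rxyE ?(rx_rhombic, ry_rhombic) ?rxyE ra rb !(intrD, intrB, intrM); split; lra.
- exists (k - b), (k - a).
  by rewrite !rxyE ?(rx_rhombic, ry_rhombic) ?rxyE ra rb !(intrD, intrB, intrM); split; lra.
- exists (2 * k - a), (a + b - k).
  by rewrite !rxyE ?(rx_rhombic, ry_rhombic) ?rxyE ra rb !(intrD, intrB, intrM); split; lra.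
Qed.

Lemma reflect_tess p q : tess_edge p q -> tess_map (reflect_line p q).
Proof. by case/tess_edge_mirror=> i [k [_ _ e]] r tr; rewrite e; apply: mirror_tess. Qed.

Lemma weyl_tess w : weyl w -> tess_map w.
Proof.
by elim=> [|p q {}w e _ tw] r tr //=; apply: (reflect_tess e); apply: tw.
Qed.

Lemma weyl_comp w1 w2 : weyl w1 -> weyl w2 -> weyl (w1 \o w2).
Proof.
by move=> h1 h2; elim: h1 => [|p q w e _ h] //; apply: (weyl_reflect e h).
Qed.

Lemma weyl_reflect1 p q : tess_edge p q -> weyl (reflect_line p q).
Proof. by move=> e; apply: (weyl_reflect e weyl_id). Qed.

Lemma weyl_mirror i (k : int) : weyl (@mirror R i k).
Proof.
have [p [q [e /funext <-]]] := mirror_edge R i k.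
exact: weyl_reflect1.
Qed.

Lemma weyl_inv w : weyl w -> exists w', [/\ weyl w', cancel w w' & cancel w' w].
Proof.
elim=> [|p q {}w e _ [w' [hw' k1 k2]]]; first by exists id; split=> //; exact: weyl_id.
exists (w' \o reflect_line p q); split.
- by apply: weyl_comp => //; apply: weyl_reflect1.
- by move=> r /=; rewrite reflect_lineK k1.
- by move=> r /=; rewrite k2 reflect_lineK.
Qed.

Lemma weyl_tessE w p : weyl w -> tess_vertex (w p) <-> tess_vertex p.
Proof.
move=> hw; split; last exact: weyl_tess.
by have [w' [hw' k _]] := weyl_inv hw; move/(weyl_tess hw'); rewrite k.
Qed.

(** The six linear parts occurring in the group: the identity, the three
    reflections in lines parallel to the sides, and the two rotations. *)
Definition wlin (j : nat) (x y : R) : R * R :=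
  nth (x, y) [:: (x, y); (x + y, - y); (- x, x + y); (- y, - x); (y, - x - y);
    (- x - y, x)] j.

(** A mirror permutes the six linear parts.  It also keeps the two components of
    the translation congruent modulo 3, because reflecting a tile in an edge
    respects the colouring of all lattice points by the labels A, B, C. *)
Lemma weyl_form w : weyl w -> exists j (m k : int), (j < 6)%N /\ forall p,
  rx (w p) = (wlin j (rx p) (ry p)).1 + m%:~R /\
  ry (w p) = (wlin j (rx p) (ry p)).2 + (m + 3 * k)%:~R.
Proof.
elim=> [|p q {}w /tess_edge_mirror[i [l [_ _ e]]] _ [j [m [k [j6 hw]]]]].
  by exists 0%N, 0, 0; split=> // p; rewrite /= !addr0.
have [j' [m' [k' [j6' H]]]] : exists j' (m' k' : int), (j' < 6)%N /\ forall p,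
  rx (mirror i l (w p)) = (wlin j' (rx p) (ry p)).1 + m'%:~R /\
  ry (mirror i l (w p)) = (wlin j' (rx p) (ry p)).2 + (m' + 3 * k')%:~R.
  have E r : (rx (mirror i l r) = rx r + (wall i r - l%:~R) * rx (wdir R i)) *
     (ry (mirror i l r) = ry r + (wall i r - l%:~R) * ry (wdir R i)).
    by rewrite /mirror !rxyE.
  (* The lists give, for each linear part, the one obtained after the mirror. *)
  elim/ord3_cases: i {e} E => E.
  - exists (nth 0 [:: 1; 0; 4; 5; 2; 3] j)%N, (m + (m + 3 * k) - l), (l - m - 2 * k).
    move: j j6 hw => [|[|[|[|[|[|//]]]]]] _ hw; split=> // r; rewrite !E /wall /wdir /=
      ?(rx_rhombic, ry_rhombic) ?rxyE (hw r).1 (hw r).2 /= !(intrD, intrB, intrM); split; lra.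
  - exists (nth 0 [:: 3; 4; 5; 0; 1; 2] j)%N, (l - m - 3 * k), k.
    move: j j6 hw => [|[|[|[|[|[|//]]]]]] _ hw; split=> // r; rewrite !E /wall /wdir /=
      ?(rx_rhombic, ry_rhombic) ?rxyE (hw r).1 (hw r).2 /= !(intrD, intrB, intrM); split; lra.
  - exists (nth 0 [:: 2; 5; 0; 4; 3; 1] j)%N, (2 * l - m), (m + k - l).
    move: j j6 hw => [|[|[|[|[|[|//]]]]]] _ hw; split=> // r; rewrite !E /wall /wdir /=
      ?(rx_rhombic, ry_rhombic) ?rxyE (hw r).1 (hw r).2 /= !(intrD, intrB, intrM); split; lra.
by exists j', m', k'; split=> // r; rewrite /= e.
Qed.

(** The closed triangle meets every orbit of the group only once.  The coordinates
    of both points lie in [0, 1], which leaves six translations for each linear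
    part; in each case the linear constraints force the points to agree. *)
Lemma triangle_weyl_eq w p : weyl w -> triangle p -> triangle (w p) -> w p = p.
Proof.
move=> /weyl_form[j [m [k [j6 /(_ p) [h1 h2]]]]] /triangle_rxyP[x0 y0 xy1].
move=> /triangle_rxyP[X0 Y0 XY1].
have [bm bn] : -1 <= m <= 2 /\ -1 <= m + 3 * k <= 2.
  rewrite -!(ler_int R).
  move: j j6 h1 h2 => [|[|[|[|[|[|//]]]]]] _ /= h1 h2; split; lra.
(* The pairs with entries in [-1, 2] that are congruent modulo 3. *)
have : [\/ (m, m + 3 * k) = (-1, -1), (m, m + 3 * k) = (0, 0) | (m, m + 3 * k) = (1, 1)] \/
  [\/ (m, m + 3 * k) = (2, 2), (m, m + 3 * k) = (-1, 2) | (m, m + 3 * k) = (2, -1)].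
  have [e|[e|[e|e]]] : m = -1 \/ m = 0 \/ m = 1 \/ m = 2 by lia.
  - have [e'|e'] : k = 0 \/ k = 1 by lia.
      by rewrite e e'; left; constructor 1. by rewrite e e'; right; constructor 2.
  - have -> : k = 0 by lia. by rewrite e; left; constructor 2.
  - have -> : k = 0 by lia. by rewrite e; left; constructor 3.
  - have [e'|e'] : k = 0 \/ k = -1 by lia.
      by rewrite e e'; right; constructor 1. by rewrite e e'; right; constructor 3.
move: (m + 3 * k) h2 {bm bn} => n h2 H.
apply: rxy_inj; move: j j6 h1 h2 => [|[|[|[|[|[|//]]]]]] _ /= h1 h2;
 by case: H => -[] [em en]; rewrite em en in h1 h2; lra.
Qed.

(** Reflecting in two parallel lines translates by twice their distance; two such
    pairs generate all translations that respect the colouring of the vertices. *)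
Lemma weyl_translation (m k : int) :
  exists2 w, weyl w & forall p, w p = rhombic p m%:~R (m + 3 * k)%:~R.
Proof.
exists ((@mirror R 0 k \o @mirror R 0 0) \o (@mirror R 1 (m + k) \o @mirror R 1 0)).
  by do !apply: weyl_comp; exact: weyl_mirror.
move=> p; apply: rxy_inj; rewrite ?(rx_rhombic, ry_rhombic) /=
  ?mirrorE /wall /= ?mirrorE /wall /= ?mirrorE
  /wall /= ?mirrorE /wall /= !(intrD, intrM); lra.
Qed.

End Weyl.

(** * Symmetries of the triangle and of the tessellation *)

Section Relabel.
Variable R : realType.
Local Notation plane := (plane R).
Implicit Types (p q r u v d : plane) (i : 'I_3) (h w g : plane -> plane) (s : {perm 'I_3}).

(** The affine map that permutes the vertices of the triangle by s. *)
Definition relabel s p : plane := \sum_i bary i p *: vertex (s i).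

Lemma bary_relabel s i p : bary (s i) (relabel s p) = bary i p.
Proof.
rewrite /relabel (reindex_inj (perm_inj (s := s^-1))) /=.
under eq_bigr do rewrite permKV.
rewrite (@bary_comb R (fun i => bary (s^-1%g i) p)) ?permK //.
by rewrite -(bary_sum p) [RHS](reindex_inj (perm_inj (s := s^-1))).
Qed.

Lemma relabel_vertex s i : relabel s (vertex i) = vertex (s i).
Proof.
have e j : bary j (@vertex R i) = (j == i)%:R.
  rewrite -[vertex i](_ : \sum_j ((j == i)%:R : R) *: vertex j = _); last first.
    rewrite (bigD1 i) //= eqxx scale1r big1 ?addr0 // => k /negbTE ->.
    by rewrite scale0r.
  rewrite (@bary_comb R (fun j => (j == i)%:R)) //.
  rewrite (bigD1 i) //= eqxx big1 ?addr0 // => k /negbTE -> //.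
rewrite /relabel (bigD1 i) //= e eqxx scale1r big1 ?addr0 // => k /negbTE ki.
by rewrite e ki scale0r.
Qed.

Lemma relabelM s s' p : relabel s' (relabel s p) = relabel (s * s')%g p.
Proof.
apply: bary_inj => i; rewrite -[i](permKV (s * s')%g) bary_relabel permM.
by rewrite !bary_relabel.
Qed.

Lemma relabel1 p : relabel 1%g p = p.
Proof. by rewrite -[RHS]baryK; apply: eq_bigr => i _; rewrite perm1. Qed.

(** This expression is symmetric in the three barycentric coordinates, so every
    relabelling of the vertices is an isometry. *)
Lemma dot_bary p q p' q' : dot (p - q) (p' - q') =
  (\sum_i (bary i p - bary i q) * (bary i p' - bary i q')) / 2.
Proof. rewrite big3 dot_rxyE /bary /= !rxyE. by lra. Qed.

Lemma relabel_affine s p v (t : R) :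
  relabel s (p + t *: v) = relabel s p + t *: lin (relabel s) v.
Proof.
rewrite /lin /relabel -sumrB scaler_sumr -big_split /=; apply: eq_bigr => i _.
rewrite -scalerBl scalerA -scalerDl; congr (_ *: _).
elim/ord3_cases: i; rewrite /bary /= !rxyE; by lra.
Qed.

Lemma relabel_motion s : motion (relabel s).
Proof.
split=> [p v t|u v]; first exact: relabel_affine.
rewrite /lin dot_bary -[u in RHS]subr0 -[v in RHS]subr0 dot_bary.
rewrite (reindex_inj (perm_inj (s := s))) /=; congr (_ / _).
by apply: eq_bigr => i _; rewrite !bary_relabel.
Qed.

Lemma relabel_triangle s p : triangle (relabel s p) <-> triangle p.
Proof.
rewrite !triangleP; split=> h i; first by rewrite -(bary_relabel s).
by rewrite -[i](permKV s) bary_relabel.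
Qed.

Lemma relabel_tess s : tess_map (relabel s).
Proof.
have tv i : exists a b : int, @vertex R i = rhombic 0 a%:~R b%:~R.
  elim/ord3_cases: i.
  - by exists 0, 1; apply: rxy_inj; rewrite ?(rx_rhombic, ry_rhombic) vertex0 !rxyE; lra.
  - by exists 0, 0; apply: rxy_inj; rewrite ?(rx_rhombic, ry_rhombic) vertex1 !rxyE; lra.
  - by exists 1, 0; apply: rxy_inj; rewrite ?(rx_rhombic, ry_rhombic) vertex2 !rxyE; lra.
move=> p /tess_vertexP[a [b [pa pb]]]; apply/tess_vertexP.
rewrite /relabel big3 /bary /= pa pb.
have [c0 [d0 ->]] := tv (s 0); have [c1 [d1 ->]] := tv (s 1).
have [c2 [d2 ->]] := tv (s 2%:R).
exists (b * c0 + (1 - a - b) * c1 + a * c2), (b * d0 + (1 - a - b) * d1 + a * d2).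
by rewrite !rxyE ?(rx_rhombic, ry_rhombic) ?rxyE !(intrD, intrB, intrM); split; lra.
Qed.

Lemma relabel_symmetry s : triangle_symmetry (relabel s).
Proof.
split=> [p q|]; last by exists s => i; rewrite relabel_vertex.
exact/enorm_motion/relabel_motion.
Qed.

(** The difference of the squared distances to two vertices is affine, so the
    three distances determine both coordinates. *)
Lemma enorm_vertex_inj p q :
  (forall i, enorm (p - vertex i) = enorm (q - vertex i)) -> p = q.
Proof.
move=> h.
have H i : dot (p - vertex i) (p - vertex i) = dot (q - vertex i) (q - vertex i).
  by rewrite -!enorm_sq h.
have := (H 0, H 1, H 2%:R); rewrite vertex0 vertex1 vertex2 !dot_rxyE !rxyE => -[[h0 h1] h2].
by apply: rxy_inj; lra.
Qed.

(** No affinity is assumed of g: its values are pinned down by their distances to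
    the three vertices. *)
Lemma symmetry_relabel g : triangle_symmetry g -> exists s, g = relabel s.
Proof.
case=> gi [s gs]; exists s; apply/funext => p; apply: enorm_vertex_inj => i.
have e h : (forall p q, enorm (h p - h q) = enorm (p - q)) ->
    (forall j, h (vertex j) = vertex (s j)) ->
    enorm (h p - vertex i) = enorm (p - vertex (s^-1%g i)).
  by move=> hi hs; rewrite -[in LHS](permKV s i) -hs hi.
rewrite (e g gi gs) e //; last exact: relabel_vertex.
by move=> q r; apply/enorm_motion/relabel_motion.
Qed.

(** Relabellings map edges of the tessellation to edges, hence normalize the
    group generated by the reflections in them. *)
Lemma relabel_weyl s w : weyl w -> exists2 w', weyl w' & relabel s \o w = w' \o relabel s.
Proof.
elim=> [|p q {}w e _ [w' hw' E]]; first by exists id => //; exact: weyl_id.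
exists (reflect_line (relabel s p) (relabel s q) \o w').
  by apply: weyl_reflect => //; apply: tess_edge_motion e;
    [exact: relabel_motion|exact: relabel_tess].
apply/funext => r /=; rewrite (reflect_line_motion _ _ _ (relabel_motion s)).
by have /(congr1 (fun f => f r)) /= -> := E.
Qed.

(** All symmetries of the tessellation, written so that the relabelling is kept
    apart: it becomes the relabelling in the identification of orbits, while the
    Weyl part disappears under folding. *)
Definition latsym h : Prop := exists s, exists2 w, weyl w & h = relabel s \o w.

Lemma latsym_weyl w : weyl w -> latsym w.
Proof.
move=> hw; exists 1%g, w => //.
by apply/funext => p /=; rewrite relabel1.
Qed.

Lemma latsym_relabel s : latsym (relabel s).
Proof. by exists s, id => //; exact: weyl_id. Qed.

Lemma latsym_comp h1 h2 : latsym h1 -> latsym h2 -> latsym (h1 \o h2).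
Proof.
move=> [s1 [w1 hw1 ->]] [s2 [w2 hw2 ->]].
have [s1' ->] : exists s', s2 = (s'^-1)%g by exists s2^-1%g; rewrite invgK.
have [w' hw' E] := relabel_weyl s1' hw1.
exists (s1'^-1 * s1)%g, (w' \o w2); first exact: weyl_comp.
apply/funext => p /=; rewrite -relabelM; congr (relabel _ _).
have /(congr1 (fun f => relabel s1'^-1%g (f (relabel s1'^-1%g (w2 p))))) /= := E.
by rewrite !relabelM mulgV mulVg !relabel1.
Qed.

Lemma latsym_inv h : latsym h -> exists h', [/\ latsym h', cancel h h' & cancel h' h].
Proof.
move=> [s [w hw ->]]; have [w' [hw' k1 k2]] := weyl_inv hw.
exists (w' \o relabel s^-1%g); split.
- by apply: latsym_comp; [exact: latsym_weyl|exact: latsym_relabel].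
- by move=> p /=; rewrite relabelM mulgV relabel1 k1.
- by move=> p /=; rewrite k2 relabelM mulVg relabel1.
Qed.

Lemma latsym_motion h : latsym h -> motion h.
Proof.
by move=> [s [w hw ->]]; apply: motion_comp; [exact: relabel_motion|exact: weyl_motion].
Qed.

Lemma latsym_tess h : latsym h -> tess_map h.
Proof. by move=> [s [w hw ->]] p tp /=; apply/relabel_tess/weyl_tess. Qed.

(** Rotating the plane by a third of a turn about B and then permuting the
    vertices cyclically translates by e1.  Horizontal translations together with
    those in the Weyl group give every lattice translation. *)
Lemma latsym_translation (a b : int) : latsym (fun p => rhombic p a%:~R b%:~R).
Proof.
(* The two mirrors through B compose to the rotation (x, y) |-> (y, - x - y). *)
have H1 : latsym (fun p => rhombic p 1 0).
  exists (perm (@addIr _ (1 : 'I_3))), (@mirror R 0 0 \o @mirror R 2%:R 0).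
    by apply: weyl_comp; exact: weyl_mirror.
  apply/funext => p; rewrite /comp /relabel big3 !permE !ord3E vertex0 vertex1 vertex2 /bary /=.
  by apply: rxy_inj; rewrite ?(rx_rhombic, ry_rhombic) !rxyE
    ?mirrorE /wall /= ?mirrorE /wall /=; lra.
have Hn (n : nat) : latsym (fun p => rhombic p n%:R 0).
  elim: n => [|n IH].
    rewrite (_ : (fun _ => _) = id); first exact: latsym_weyl (weyl_id _).
    by apply/funext => p; apply: rxy_inj; rewrite ?(rx_rhombic, ry_rhombic) addr0.
  have := latsym_comp H1 IH; congr latsym; apply/funext => p /=.
  by apply: rxy_inj; rewrite ?(rx_rhombic, ry_rhombic) ?[n.+1%:R]mulrS; lra.
have Hz (c : int) : latsym (fun p => rhombic p c%:~R 0).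
  case: c => n; first exact: Hn.
  have [h' [hh' k1 k2]] := latsym_inv (Hn n.+1).
  rewrite (_ : (fun _ => _) = h') //; apply/funext => p.
  rewrite -[p in RHS](_ : rhombic (rhombic p (Negz n)%:~R 0) n.+1%:R 0 = p) ?k1 //.
  by apply: rxy_inj; rewrite ?(rx_rhombic, ry_rhombic) ?NegzE ?intrN; lra.
have [w hw E] := weyl_translation R b 0.
have := latsym_comp (Hz (a - b)) (latsym_weyl hw); congr latsym; apply/funext => p /=.
by apply: rxy_inj; rewrite ?(rx_rhombic, ry_rhombic) ?E
  ?(rx_rhombic, ry_rhombic) ?mulr0 ?addr0 ?intrB; lra.
Qed.
End Relabel.

(** * The triangle as a fundamental domain *)

Section Folding.
Variable R : realType.
Local Notation plane := (plane R).
Implicit Types (p q r u v d : plane) (i j : 'I_3) (h w g : plane -> plane).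

Definition side_mirror i : plane -> plane := reflect_line (vertex (i + 1)) (vertex (i + 2%:R)).

Lemma vertex_tess i : tess_vertex (@vertex R i).
Proof.
apply/tess_vertexP; elim/ord3_cases: i.
- by exists 0, 1; rewrite vertex0 !rxyE.
- by exists 0, 0; rewrite vertex1 !rxyE.
- by exists 1, 0; rewrite vertex2 !rxyE.
Qed.

Lemma side_edge i : tess_edge (@vertex R (i + 1)) (vertex (i + 2%:R)).
Proof.
split; [exact: vertex_tess|exact: vertex_tess|].
rewrite /enorm -[RHS]sqrtr1; congr Num.sqrt; rewrite dot_rxyE.
by elim/ord3_cases: i; rewrite !ord3E ?vertex0 ?vertex1 ?vertex2 !rxyE; lra.
Qed.

Lemma weyl_side_mirror i : weyl (side_mirror i).
Proof. exact/weyl_reflect1/side_edge. Qed.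

Lemma side_mirror_lin i v : lin (side_mirror i) v = reflect_dir (side_dir i) v.
Proof. by rewrite /side_mirror reflect_line_lin. Qed.

Lemma side_mirrorE i : side_mirror i = mirror i (nth 0 [:: 0; 1; 0] i).
Proof.
apply/funext; apply: reflect_line_mirror.
- have [_ _] := side_edge i; rewrite -opprB /enorm dotNl dotNr opprK => e.
  by rewrite -[LHS]sqr_sqrtr ?dot_ge0 // e expr1n.
- by elim/ord3_cases: i; rewrite !ord3E ?vertex0 ?vertex1 ?vertex2 /wall /= !rxyE; lra.
- by elim/ord3_cases: i; rewrite !ord3E ?vertex0 ?vertex1 ?vertex2 /wall /= !rxyE; lra.
Qed.

(** In barycentric coordinates the mirror in side i exchanges the two half-planes
    bounded by that side and fixes the side. *)
Lemma bary_side_mirror i j p :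
  bary j (side_mirror i p) = if j == i then - bary i p else bary j p + bary i p.
Proof.
rewrite side_mirrorE.
by elim/ord3_cases: i; elim/ord3_cases: j; rewrite /bary /= ?mirrorE /wall /=; lra.
Qed.

Lemma side_mirror_fix i p : bary i p = 0 -> side_mirror i p = p.
Proof.
move=> p0; apply: bary_inj => j; rewrite bary_side_mirror p0 oppr0 addr0.
by case: eqP => [->|].
Qed.

Lemma bary_affine i p v (t : R) :
  bary i (p + t *: v) = bary i p + t * (bary i (p + v) - bary i p).
Proof. by elim/ord3_cases: i; rewrite /bary /= !rxyE; lra. Qed.

(** The lines of the tessellation are the sets where a barycentric coordinate
    takes an integer value. *)
Definition on_wall p := exists i (k : int), bary i p = k%:~R.

Lemma on_wall_mirror i (k : int) p : on_wall p -> on_wall (mirror i k p).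
Proof.
case=> j [m]; elim/ord3_cases: i; elim/ord3_cases: j; rewrite /bary /= => e;
 rewrite /on_wall /bary.
- exists 0, (2 * k - m). by rewrite /= ?mirrorE /wall /= !(intrD, intrB, intrM); lra.
- exists 2%:R, (1 - k - m). by rewrite /= ?mirrorE /wall /= !(intrD, intrB, intrM); lra.
- exists 1, (1 - k - m). by rewrite /= ?mirrorE /wall /= !(intrD, intrB, intrM); lra.
- exists 2%:R, (k - m). by rewrite /= ?mirrorE /wall /= !(intrD, intrB, intrM); lra.
- exists 1, (2 - 2 * k - m). by rewrite /= ?mirrorE /wall /= !(intrD, intrB, intrM); lra.
- exists 0, (k - m). by rewrite /= ?mirrorE /wall /= !(intrD, intrB, intrM); lra.
- exists 1, (1 - k - m). by rewrite /= ?mirrorE /wall /= !(intrD, intrB, intrM); lra.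
- exists 0, (1 - k - m). by rewrite /= ?mirrorE /wall /= !(intrD, intrB, intrM); lra.
- exists 2%:R, (2 * k - m). by rewrite /= ?mirrorE /wall /= !(intrD, intrB, intrM); lra.
Qed.

Lemma on_wall_weyl w p : weyl w -> on_wall (w p) <-> on_wall p.
Proof.
have H h q : weyl h -> on_wall q -> on_wall (h q).
  elim=> [|a b {}w /tess_edge_mirror[i [k [_ _ e]]] _ IH] // hq.
  by rewrite /= e; apply: on_wall_mirror; apply: IH.
move=> hw; split; last exact: H.
by have [w' [hw' k1 _]] := weyl_inv hw; move/(H _ _ hw'); rewrite k1.
Qed.

(** A barycentric coordinate of a point of the triangle lies in [0, 1]; if it is
    1, the point is a vertex. *)
Lemma boundaryP p : triangle p -> boundary p <-> on_wall p.
Proof.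
move=> tp; split=> [[i /sideP[_ e]]|[i [k e]]]; first by exists i, 0.
have /triangleP h := tp.
have [k0|k1] : k = 0 \/ k = 1.
  have := h i; have : \sum_j bary j p = 1 by exact: bary_sum.
  rewrite big3 e ler0z => s k0.
  have : k <= 1.
    rewrite -(ler_int R) -e; have := (h 0, h 1, h 2%:R); move: s => s [[]].
    by elim/ord3_cases: i {e}; lra.
  by lia.
  by exists i; apply/sideP; rewrite e k0.
exists (i + 1); apply/sideP; split=> //.
have := (h 0, h 1, h 2%:R); have : \sum_j bary j p = 1 by exact: bary_sum.
rewrite big3 => s [[]]; move: e; rewrite k1.
by elim/ord3_cases: i; rewrite ?ord3E; lra.
Qed.

Lemma tess_triangle p : triangle p -> tess_vertex p -> exists i, p = vertex i.
Proof.
move=> /triangle_rxyP[x0 y0 xy1] /tess_vertexP[a [b [ea eb]]].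
move: x0 y0 xy1; rewrite ea eb -intrD !ler0z -[1]/(1%:~R) ler_int => a0 b0 ab.
have [[a1 b1]|[[a1 b1]|[a1 b1]]] : (a = 0 /\ b = 1) \/ (a = 0 /\ b = 0) \/ (a = 1 /\ b = 0).
  by lia.
- by exists 0; rewrite vertex0; apply: rxy_inj; rewrite ?ea ?eb ?rxyE ?a1 ?b1.
- by exists 1; rewrite vertex1; apply: rxy_inj; rewrite ?ea ?eb ?rxyE ?a1 ?b1.
- by exists 2%:R; rewrite vertex2; apply: rxy_inj; rewrite ?ea ?eb ?rxyE ?a1 ?b1.
Qed.

Lemma two_sides_vertex i j p : i != j -> bary i p = 0 -> bary j p = 0 -> tess_vertex p.
Proof.
move=> ij bi bj; apply/tess_vertexP; move: bi bj ij.
by elim/ord3_cases: i; elim/ord3_cases: j; rewrite /bary //= => b1 b2 _;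
  [exists 1, 0|exists 0, 0|exists 1, 0|exists 0, 1|exists 0, 0|exists 0, 1];
  rewrite /=; split; lra.
Qed.

(** An integer translation brings the point into the unit rhombus, and the mirror
    in its short diagonal into the triangle.  This symmetry of the tessellation
    may involve a relabelling, but relabelling preserves the triangle. *)
Lemma weyl_to_triangle p : exists2 w, weyl w & triangle (w p).
Proof.
suff [h [s [w hw ->]]] : exists2 h, latsym h & triangle (h p).
  by rewrite /= relabel_triangle => t; exists w.
pose a := Num.floor (rx p); pose b := Num.floor (ry p).
have /andP[a0 a1] := floor_itv (rx p).
have /andP[b0 b1] := floor_itv (ry p).
have hT := latsym_translation R (- a) (- b).
have [le1|gt1] := leP (rx p - a%:~R + (ry p - b%:~R)) 1.
  exists (fun p => rhombic p (- a)%:~R (- b)%:~R) => //.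
  by apply/triangle_rxyP; rewrite ?(rx_rhombic, ry_rhombic) !intrN;
    split; rewrite /a /b in le1 *; lra.
exists (mirror 1 1 \o (fun p => rhombic p (- a)%:~R (- b)%:~R)).
  by apply: latsym_comp => //; apply/latsym_weyl/weyl_mirror.
move: a1 b1; rewrite -/a -/b !intrD => a1 b1.
apply/triangle_rxyP; rewrite /= !mirrorE /wall /= ?(rx_rhombic, ry_rhombic) !intrN;
  split; rewrite /a /b in gt1 a1 b1 *; lra.
Qed.

(** The finite reflection group of linear parts has the sector of directions
    with inclination in [0, 60] degrees as a chamber. *)
Lemma weyl_chamber v : exists2 w, weyl w & 0 <= rx (lin w v) /\ 0 <= ry (lin w v).
Proof.
have L (i : 'I_3) u : lin (mirror i 0) u = mirror i 0 u.
  by rewrite /lin; apply: rxy_inj; rewrite ?rxyE ?mirrorE ?rxyE /wall;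
    elim/ord3_cases: i; rewrite /= ?rxyE; lra.
have M i := weyl_mirror R i 0.
have M2 i j := weyl_comp (M i) (M j).
have L2 (i j : 'I_3) u : lin (mirror i 0 \o mirror j 0) u = mirror i 0 (mirror j 0 u).
  by rewrite lin_comp ?L //; apply/weyl_motion.
have [x0|x0] := leP 0 (rx v); have [y0|y0] := leP 0 (ry v); have [z0|z0] := leP 0 (rx v + ry v).
- by exists id; [exact: weyl_id|rewrite lin_id].
- by lra.
- by exists (mirror 0 0) => //; rewrite L !mirrorE /wall /=; lra.
- by exists (mirror 2%:R 0 \o mirror 0 0) => //;
    rewrite L2 !mirrorE /wall /= !mirrorE /wall /=; lra.
- by exists (mirror 2%:R 0) => //; rewrite L !mirrorE /wall /=; lra.
- by exists (mirror 0 0 \o mirror 2%:R 0) => //;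
    rewrite L2 !mirrorE /wall /= !mirrorE /wall /=; lra.
- by lra.
- by exists (mirror 1 0) => //; rewrite L !mirrorE /wall /=; lra.
Qed.

(** Exchanging A and C reflects in the bisector at B, which halves the chamber of
    the Weyl group; the half kept consists of the inclinations in [30, 60]
    degrees. *)
Lemma sector_exists v : exists2 h, latsym h & 0 <= rx (lin h v) <= ry (lin h v).
Proof.
have [w hw [x0 y0]] := weyl_chamber v.
have [le|gt] := leP (rx (lin w v)) (ry (lin w v)).
  by exists w; [exact: latsym_weyl|lra].
pose s : {perm 'I_3} := tperm 0 2%:R.
exists (relabel s \o w).
  by apply: latsym_comp; [exact: latsym_relabel|exact: latsym_weyl].
rewrite lin_comp; last exact: relabel_motion.
move: (lin w v) x0 y0 gt => u x0 y0 gt.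
have s0 : s 0 = 2%:R by rewrite tpermL.
have s2 : s 2%:R = 0 by rewrite tpermR.
have s1 : s 1 = 1 by rewrite tpermD.
have E q : ((rx (relabel s q) = ry q) * (ry (relabel s q) = rx q))%type.
  have := (bary_relabel s 0 q, bary_relabel s 2%:R q).
  by rewrite s0 s2 /bary /=; case.
by rewrite /lin !rxyE !E !rxyE; lra.
Qed.

End Folding.

(** * Trajectories are folded lines *)

Section Trajectories.
Variable R : realType.
Local Notation plane := (plane R).
Implicit Types (p q r u v d P : plane) (i j : 'I_3) (h w g : plane -> plane)
  (f : R -> plane) (s t : R).

(** If the property failed somewhere, it would hold up to the supremum of the
    initial segments on which it holds, at it, and then beyond it. *)
Lemma real_induction (A : R -> Prop) (a : R) : A a ->
  (forall t, a <= t -> A t -> exists2 e, 0 < e & forall s, t <= s < t + e -> A s) ->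
  (forall t, a < t -> (forall s, a <= s < t -> A s) -> A t) ->
  forall t, a <= t -> A t.
Proof.
move=> Aa right left b ab; apply: contrapT => nAb.
pose S := [set t | a <= t /\ forall s, a <= s <= t -> A s].
have Sa : S a by split=> // s sa; have -> : s = a by lra.
have Sub t : S t -> t <= b.
  by case=> at_ h; have [//|bt] := leP t b; case: nAb; apply: h; rewrite ab ltW.
have hS : has_sup S by split; [exists a|exists b => t /Sub].
have ac : a <= sup S by apply: sup_upper_bound.
have below s : a <= s < sup S -> A s.
  move=> /andP[as_ sS]; have e0 : 0 < sup S - s by lra.
  have [t [_ ht] lt] := sup_adherent e0 hS; apply: ht. by lra.
have Ac : A (sup S).
  have [lt|ge] := ltP a (sup S); first exact: left.
  by have -> : sup S = a by lra.
have [e e0 he] := right _ ac Ac.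
have : S (sup S + e / 2).
  split=> [|s /andP[s1 s2]]; first by lra.
  have [ge|lt] := leP (sup S) s; last by apply: below; lra.
  by apply: he; lra.
move/(sup_upper_bound hS). by lra.
Qed.

Lemma stays_nonneg (a b : R) : 0 < a ->
  exists2 e, 0 < e & forall s, 0 <= s <= e -> 0 <= a + s * b.
Proof.
move=> a0; exists (a / (`|b| + 1)); first by rewrite divr_gt0 // ltr_wpDl.
move=> s /andP[s0 se].
have b1 : 0 < `|b| + 1 by rewrite ltr_wpDl.
have : s * (`|b| + 1) <= a by rewrite -ler_pdivlMr.
have := ler_norm (- b); rewrite normrN. by nra.
Qed.

Lemma departs_unique f t u v : departs f t u -> departs f t v -> u = v.
Proof.
move=> [e e0 he] [e' e0' he'].
pose s := Num.min e e'.
have s0 : 0 < s by rewrite lt_min e0.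
have hs : 0 <= s <= e by rewrite ltW //= ge_min lexx.
have hs' : 0 <= s <= e' by rewrite ltW //= ge_min lexx orbT.
have := he s hs; rewrite (he' s hs') => /addrI /(congr1 ( *:%R s^-1)).
by rewrite !scalerA mulVf ?gt_eqF // !scale1r.
Qed.

Lemma departs_reverse f t u : arrives f t u <-> departs (fun s => f (- s)) (- t) (- u).
Proof.
have E s : - (- t + s) = t - s by lra.
by split=> -[e e0 he]; exists e => // s hs; have := he s hs; rewrite E opprK scalerN.
Qed.

Lemma arrives_reverse f t u : departs f t u <-> arrives (fun s => f (- s)) (- t) (- u).
Proof.
have E s : - (- t - s) = t + s by lra.
by split=> -[e e0 he]; exists e => // s hs; have := he s hs; rewrite E opprK scalerN opprK.
Qed.

Lemma arrives_unique f t u v : arrives f t u -> arrives f t v -> u = v.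
Proof.
by move=> /departs_reverse h1 /departs_reverse h2; apply: oppr_inj; apply: departs_unique h1 h2.
Qed.

Lemma departs_straight f t v : departs f t v -> exists2 e, 0 < e & forall s,
  t <= s < t + e -> departs f s v /\ f s = f t + (s - t) *: v.
Proof.
case=> e e0 he; exists e => // s /andP[ts se].
have E (x : R) : 0 <= x <= e -> f (t + x) = f t + x *: v by exact: he.
have fs : f s = f t + (s - t) *: v by rewrite -E; [congr f; lra|lra].
split=> //; exists (t + e - s); first by lra.
move=> x /andP[x0 xe]; rewrite fs -addrA -scalerDl -E; last by lra.
by congr f; lra.
Qed.

Lemma arrives_straight f t u : arrives f t u -> exists2 e, 0 < e & forall s,
  t - e <= s < t -> departs f s u /\ f t = f s + (t - s) *: u.
Proof.
case=> e e0 he; exists e => // s /andP[ts se].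
have E (x : R) : 0 <= x <= e -> f (t - x) = f t - x *: u by exact: he.
have fs : f s = f t - (t - s) *: u by rewrite -E; [congr f; lra|lra].
split; last by rewrite fs subrK.
exists (t - s); first by lra.
move=> x /andP[x0 xe]; rewrite fs -addrA -scaleNr -scalerDl.
have -> : - (t - s) + x = - (t - s - x) :> R by lra.
by rewrite scaleNr -E; [congr f; lra|lra].
Qed.

Lemma nonsingular_reverse f :
  nonsingular_trajectory f -> nonsingular_trajectory (fun s => f (- s)).
Proof.
case=> c c0 h; exists c => // t.
have [h1 h2 [u [v [hu hv [nu nv] hb hs]]]] := h (- t).
have N (x : plane) : enorm (- x) = enorm x by rewrite -scaleN1r enormZ normrN normr1 mul1r.
split=> //; exists (- v), (- u); split.
- by have := (arrives_reverse f (- t) v).1 hv; rewrite opprK.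
- by have := (departs_reverse f (- t) u).1 hu; rewrite opprK.
- by rewrite !N.
- by move/hb => ->.
- by move=> i /hs ->; rewrite reflect_dirN reflect_dirK.
Qed.

(** f is the image, under folding the plane onto the triangle, of a uniform
    motion along a line that misses all vertices of the tessellation. *)
Definition folds f P v : Prop :=
  [/\ v <> 0, forall t, ~ tess_vertex (P + t *: v) &
    forall t, triangle (f t) /\ exists2 w, weyl w & f t = w (P + t *: v)].

(** Real induction on time.  Away from strikes the same group element works; at a
    strike on side i it is composed with the mirror in side i, which fixes the
    point of impact and whose linear part is the law of reflection. *)
Lemma unfold_forward f t0 v : nonsingular_trajectory f -> departs f t0 v ->
  forall t, t0 <= t -> exists2 w, weyl w & f t = w (f t0 + (t - t0) *: v) /\
    departs f t (lin w v).
Proof.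
move=> [c c0 hf] hd; apply: real_induction.
- by exists id; [exact: weyl_id|rewrite subrr scale0r addr0 lin_id].
- move=> t tt0 [w hw [ft dt]]; have [e e0 he] := departs_straight dt; exists e => // s hs.
  have [ds fs] := he s hs; exists w => //; split=> //.
  have [mw _] := weyl_motion hw.
  rewrite fs ft -mw -addrA -scalerDl; congr (w (_ + _ *: _)); lra.
- move=> t tt0 IH; have [_ _ [u [v' [hu hv _ hb hs]]]] := hf t.
  have [e e0 he] := arrives_straight hu.
  pose s := Num.max t0 (t - e).
  have hs0 : t0 <= s by rewrite le_max lexx.
  have hst : s < t by rewrite gt_max tt0 /=; lra.
  have hse : t - e <= s by rewrite le_max lexx orbT.
  have [ds ft] : departs f s u /\ f t = f s + (t - s) *: u by apply: he; rewrite hse.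
  have [w hw [fs dw]] : exists2 w, weyl w & f s = w (f t0 + (s - t0) *: v) /\
    departs f s (lin w v) by apply: IH; rewrite hs0.
  have eu := departs_unique ds dw.
  have [mw _] := weyl_motion hw.
  have {}ft : f t = w (f t0 + (t - t0) *: v).
    rewrite ft fs eu -mw -addrA -scalerDl; congr (w (_ + _ *: _)); lra.
  have [bt|nbt] := pselect (boundary (f t)); last first.
    by exists w => //; split=> //; rewrite -eu -(hb nbt).
  case: (bt) => i si; exists (side_mirror i \o w).
    by apply: weyl_comp => //; exact: weyl_side_mirror.
  rewrite lin_comp; last by apply: weyl_motion; exact: weyl_side_mirror.
  rewrite /= -ft side_mirror_lin -eu -(hs i si); split=> //.
  by rewrite side_mirror_fix //; case/sideP: si.
Qed.

Lemma straight_between_strikes f s s' v : nonsingular_trajectory f -> departs f s v ->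
  (forall t, s < t < s' -> ~ boundary (f t)) ->
  forall t, s <= t <= s' -> f t = f s + (t - s) *: v.
Proof.
move=> [c c0 hf] hd nb t /andP[st ts].
suff : t <= s' -> f t = f s + (t - s) *: v /\ (t < s' -> departs f t v) by case.
move: t st {ts}; apply: real_induction => [_||].
- by rewrite subrr scale0r addr0.
- move=> t st IH.
  have [ts|ts] := ltP t s'; last first.
    exists 1 => // x hx xs; have -> : x = t by lra.
    apply: IH; lra.
  have [ft /(_ ts) dt] := IH (ltW ts).
  have [e e0 he] := departs_straight dt; exists e => // x hx _.
  have [dx fx] := he x hx; split=> //; rewrite fx ft -addrA -scalerDl.
  by congr (_ + _ *: _); lra.
- move=> t st IH ts; have [_ _ [u [v' [hu hv _ hb hs]]]] := hf t.
  have [e e0 he] := arrives_straight hu.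
  pose x := Num.max s (t - e).
  have hx0 : s <= x by rewrite le_max lexx.
  have hxt : x < t by rewrite gt_max st /=; lra.
  have hxe : t - e <= x by rewrite le_max lexx orbT.
  have [dx ft] : departs f x u /\ f t = f x + (t - x) *: u by apply: he; rewrite hxe.
  have [] : f x = f s + (x - s) *: v /\ (x < s' -> departs f x v).
    by apply: IH; [rewrite hx0|lra].
  move=> fx /(_ (lt_le_trans hxt ts)) dx'; have eu := departs_unique dx dx'.
  split=> [|ts'].
    by rewrite ft fx eu -addrA -scalerDl; congr (_ + _ *: _); lra.
  by rewrite -eu -hb //; apply: nb; rewrite st.
Qed.

(** For times before t, reverse the direction of travel.  If t is a strike, the
    reversed path leaves along the reflected direction, which is compensated by
    one mirror in the side struck. *)
Lemma nonsingular_folds f t v : nonsingular_trajectory f -> departs f t v ->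
  folds f (f t - t *: v) v.
Proof.
move=> hf hd; case: (hf) => c c0 hf'.
have zE s : f t - t *: v + s *: v = f t + (s - t) *: v.
  by rewrite -addrA -scaleNr -scalerDl; congr (_ + _ *: _); lra.
have H s : exists2 w, weyl w & f s = w (f t - t *: v + s *: v).
  rewrite zE; have [ts|st] := leP t s.
    by have [w hw [e _]] := unfold_forward hf hd ts; exists w.
  have [_ _ [u [v' [hu hv _ hb hs]]]] := hf' t.
  have ev := departs_unique hd hv; subst v'.
  have [w hw [e _]] : exists2 w, weyl w & f (- - s) = w (f (- - t) + (- s - - t) *: (- u)) /\
    departs (fun s => f (- s)) (- s) (lin w (- u)).
    apply: (unfold_forward (nonsingular_reverse hf)); last by lra.
    exact/departs_reverse.
  move: e; rewrite !opprK scalerN -scaleNr opprD !opprK => e.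
  have [bt|nbt] := pselect (boundary (f t)); last first.
    by exists w => //; rewrite e (hb nbt).
  case: (bt) => i si; exists (w \o side_mirror i).
    by apply: weyl_comp => //; exact: weyl_side_mirror.
  rewrite e /= (hs i si).
  have [ms _] := weyl_motion (weyl_side_mirror R i).
  rewrite ms side_mirror_lin reflect_dirK side_mirror_fix //.
  by case/sideP: si.
split.
- move=> v0; have [_ _ [u [v' [_ hv [_ nv] _ _]]]] := hf' t.
  move: nv; rewrite -(departs_unique hd hv) v0 => c0'.
  move: c0; rewrite -c0' /enorm dot_rxyE !rxyE !(mul0r, addr0) sqrtr0 ltxx //.
- move=> s; have [w hw e] := H s => tz.
  have [h1 h2 _] := hf' s; have /(tess_triangle h1)[i] : tess_vertex (f s).
    by rewrite e; apply: weyl_tess.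
  exact: h2.
- by move=> s; split=> //; have [h1 _ _] := hf' s.
Qed.

Lemma fold_unique p q r w w' : weyl w -> weyl w' -> p = w r -> q = w' r ->
  triangle p -> triangle q -> p = q.
Proof.
move=> hw hw' -> ->; have [u [hu k1 k2]] := weyl_inv hw' => tp tq.
have := triangle_weyl_eq (weyl_comp hw hu) tq; rewrite /= k1 => H.
exact: H.
Qed.

(** For a short time after t the folded line moves straight from f t.  It does so
    in the direction given by w0, unless this leads out of the triangle; as f t
    is not a vertex, it then crosses a single side i, and the line continues
    in the triangle after composing with the mirror in side i. *)
Lemma folds_right f P v t w0 : folds f P v -> weyl w0 -> f t = w0 (P + t *: v) ->
  exists2 e, 0 < e &
  (forall s, 0 <= s <= e -> f (t + s) = f t + s *: lin w0 v) \/
  exists i, [/\ bary i (f t) = 0,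
   forall s, 0 <= s <= e -> f (t + s) = f t + s *: lin (side_mirror i \o w0) v &
   bary i (f t + lin w0 v) < 0].
Proof.
move=> [v0 nv hf] hw e0; have [mw _] := weyl_motion hw.
have tf := (hf t).1; have /triangleP bf := tf.
have U w s : weyl w -> w (P + t *: v) = f t -> triangle (f t + s *: lin w v) ->
    f (t + s) = f t + s *: lin w v.
  move=> hw1 e1 tr; have [mw1 _] := weyl_motion hw1.
  have [tf' [w' hw' e']] := hf (t + s).
  apply: (fold_unique hw' hw1 e') => //.
  by rewrite -e1 -mw1 -addrA -scalerDl.
have pos3 (F : 'I_3 -> R -> Prop) :
    (forall i, exists2 e, 0 < e & forall s, 0 <= s <= e -> F i s) ->
    exists2 e, 0 < e & forall s, 0 <= s <= e -> forall i, F i s.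
  move=> hF; have [e1 e10 h1] := hF 0; have [e2 e20 h2] := hF 1; have [e3 e30 h3] := hF 2%:R.
  exists (Num.min e1 (Num.min e2 e3)); first by rewrite !lt_min e10 e20.
  move=> s /andP[s0]; rewrite !le_min => /and3P[l1 l2 l3].
  by elim/ord3_cases; [apply: h1|apply: h2|apply: h3]; rewrite s0.
have [[i [bi ui]]|no] := pselect (exists i, bary i (f t) = 0 /\ bary i (f t + lin w0 v) < 0);
  last first.
  have [e ep he] : exists2 e, 0 < e & forall s, 0 <= s <= e -> forall i,
      0 <= bary i (f t + s *: lin w0 v).
    apply: pos3 => i; move: (bf i); rewrite le_eqVlt => /orP[/eqP b0|bp].
      exists 1 => // s /andP[s0 _]; rewrite bary_affine -b0 add0r subr0 mulr_ge0 //.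
      by rewrite leNgt; apply/negP => lt0; case: no; exists i.
    have [e ep he] := stays_nonneg (bary i (f t + lin w0 v) - bary i (f t)) bp.
    by exists e => // s /he; rewrite bary_affine.
  exists e => //; left=> s hs; apply: U => //.
  by apply/triangleP; exact: he.
have bpos j : j != i -> 0 < bary j (f t).
  move=> ji; rewrite lt0r bf andbT; apply/eqP => bj.
  have := two_sides_vertex ji bj bi; rewrite e0 (weyl_tessE _ hw); exact: nv.
have hsw : weyl (side_mirror i \o w0) by apply: weyl_comp => //; exact: weyl_side_mirror.
have msm := weyl_motion (weyl_side_mirror R i).
have bv j : bary j (f t + lin (side_mirror i \o w0) v) =
    if j == i then - bary i (f t + lin w0 v) else bary j (f t + lin w0 v) + bary i (f t + lin w0 v).
  rewrite lin_comp // -[f t in LHS](side_mirror_fix bi) -motionD //.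
  by rewrite bary_side_mirror.
have [e ep he] : exists2 e, 0 < e & forall s, 0 <= s <= e -> forall j,
    0 <= bary j (f t + s *: lin (side_mirror i \o w0) v).
  apply: pos3 => j; have [->|ji] := eqVneq j i.
    exists 1 => // s /andP[s0 _]; rewrite bary_affine bi add0r subr0 bv eqxx mulr_ge0 //.
    by rewrite oppr_ge0 ltW.
  have [e ep he] :=
    stays_nonneg (bary j (f t + lin (side_mirror i \o w0) v) - bary j (f t)) (bpos j ji).
  by exists e => // s /he; rewrite bary_affine.
exists e => //; right; exists i; split=> // s hs; apply: U => //.
  by rewrite /= -e0 side_mirror_fix.
by apply/triangleP; exact: he.
Qed.

End Trajectories.

(** * Folded lines are trajectories; identification of orbits *)

Section FoldedLines.
Variable R : realType.
Local Notation plane := (plane R).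
Implicit Types (p q r u v d P V : plane) (i j : 'I_3) (h w g : plane -> plane)
  (f : R -> plane) (s t : R) (a b : billiard_orbit R) (sg : {perm 'I_3}).

Lemma folds_reverse f P v : folds f P v -> folds (fun t => f (- t)) P (- v).
Proof.
have E t : P + t *: (- v) = P + (- t) *: v by rewrite scalerN scaleNr.
case=> v0 nv hf; split.
- by move/eqP; rewrite oppr_eq0 => /eqP.
- by move=> t; rewrite E.
- by move=> t; rewrite E.
Qed.

Lemma folds_departs f P v t : folds f P v -> exists2 w, weyl w &
  f t = w (P + t *: v) /\ departs f t (lin w v).
Proof.
move=> hf; have [_ _ /(_ t)[tf [w hw e]]] := hf.
have [e0 ep [h|[i [bi h _]]]] := folds_right hf hw e.
  by exists w => //; split=> //; exists e0.
exists (side_mirror i \o w); first by apply: weyl_comp => //; exact: weyl_side_mirror.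
by split; [rewrite /= -e side_mirror_fix|exists e0].
Qed.

(** Comparing the motion just after t with the one just before: if the line
    crosses side i at t, exactly one of the two directions is reflected in side
    i, which is the law of reflection; if it does not cross, the two directions
    agree, and they are parallel to any side that contains the point. *)
Lemma folds_nonsingular f P v : folds f P v -> nonsingular_trajectory f.
Proof.
move=> hf; have [v0 nv hft] := hf.
exists (enorm v); first exact: enorm_gt0.
move=> t; have [tf [w hw e]] := hft t.
have ntv : ~ tess_vertex (f t) by rewrite e (weyl_tessE _ hw).
split=> //; first by move=> i ei; apply: ntv; rewrite ei; exact: vertex_tess.
have mw := weyl_motion hw.
have nref d (x : plane) : enorm (reflect_dir d x) = enorm x.
  by rewrite /enorm reflect_dir_dot.
have er : (fun s => f (- s)) (- t) = w (P + (- t) *: (- v)).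
  by rewrite opprK scaleNr scalerN opprK.
have mi i : motion (@side_mirror R i) by apply/weyl_motion/weyl_side_mirror.
have uniq_side i j : bary i (f t) = 0 -> side j (f t) -> j = i.
  move=> bi /sideP[_ bj]; apply/eqP/negPn/negP => ji; exact: ntv (two_sides_vertex ji bj bi).
set u0 := lin w v.
have right : departs f t u0 \/ exists i, [/\ bary i (f t) = 0,
    departs f t (reflect_dir (side_dir i) u0) & bary i (f t + u0) < 0].
  have [e0 ep [h|[i [bi h lt]]]] := folds_right hf hw e; first by left; exists e0.
  by right; exists i; split=> //; exists e0 => //; rewrite -side_mirror_lin -(lin_comp w v (mi i)).
have left : arrives f t u0 \/ exists i, [/\ bary i (f t) = 0,
    arrives f t (reflect_dir (side_dir i) u0) & bary i (f t - u0) < 0].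
  have [e0 ep [h|[i [bi h lt]]]] := folds_right (folds_reverse hf) hw er.
    by left; apply/departs_reverse; exists e0 => //; rewrite -/u0 -linN.
  right; exists i; move: bi h lt; rewrite opprK (linN v mw) -/u0 => bi h lt; split=> //.
  apply/departs_reverse; exists e0 => // s hs.
  by rewrite h // (lin_comp w (- v) (mi i)) (linN v mw) side_mirror_lin reflect_dirN opprK.
have bd i : bary i (f t) = 0 -> boundary (f t) by exists i; apply/sideP.
case: right => [dt|[i [bi dt lti]]]; case: left => [at_|[j [bj at_ ltj]]].
- exists u0, u0; split=> //; first by rewrite enorm_lin.
  move=> i /sideP[_ bi].
  have bge x : departs f t x -> 0 <= bary i (f t + x).
    case=> e1 e10 /(_ e1); rewrite lexx ltW // => /(_ isT) fe.
    have /triangleP/(_ i) := (hft (t + e1)).1.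
    by rewrite fe bary_affine bi add0r subr0 pmulr_rge0.
  have ble : 0 <= bary i (f t - u0).
    case: at_ => e1 e10 /(_ e1); rewrite lexx ltW // => /(_ isT) fe.
    have /triangleP/(_ i) := (hft (t - e1)).1.
    by rewrite fe -scalerN bary_affine bi add0r subr0 pmulr_rge0.
  have b0 : bary i (f t + u0) = 0.
    have := bge _ dt; have := bary_affine i (f t) u0 (-1); rewrite scaleN1r.
    by move: ble; rewrite bi; lra.
  rewrite -side_mirror_lin; apply: (@addrI _ (f t)).
  by rewrite -[f t in RHS](side_mirror_fix bi) -motionD // side_mirror_fix.
- exists (reflect_dir (side_dir j) u0), u0; split=> //.
  + by rewrite nref enorm_lin.
  + by move/(_ (bd _ bj)).
  + by move=> k /(uniq_side _ _ bj) ->; rewrite reflect_dirK.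
- exists u0, (reflect_dir (side_dir i) u0); split=> //.
  + by rewrite nref enorm_lin.
  + by move/(_ (bd _ bi)).
  + by move=> k /(uniq_side _ _ bi) ->.
- have [ij|ij] := eqVneq i j; last by case: ntv; exact: two_sides_vertex ij bi bj.
  subst j; have := bary_affine i (f t) u0 (-1); rewrite scaleN1r.
  by move: lti ltj; rewrite bi; lra.
Qed.

(** Both lines are carried by group elements to the actual departure of f at time
    0, hence to each other. *)
Lemma folds_change f P v P' v' : folds f P v -> folds f P' v' ->
  exists2 w, weyl w & P' = w P /\ v' = lin w v.
Proof.
move=> h1 h2; have [w1 hw1 [e1 d1]] := folds_departs 0 h1.
have [w2 hw2 [e2 d2]] := folds_departs 0 h2.
have [w [hw k1 k2]] := weyl_inv hw2.
exists (w \o w1); first exact: weyl_comp.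
have mw := weyl_motion hw.
rewrite (lin_comp w1 v mw) (departs_unique d1 d2) -(lin_comp w2 v' mw).
have -> : w \o w2 = id by apply/funext => x /=; rewrite k1.
rewrite lin_id; split=> //=; move: e1 e2; rewrite !scale0r !addr0 => <- ->.
by rewrite k1.
Qed.

Lemma fold_subproof p : exists q, triangle q /\ exists2 w, weyl w & q = w p.
Proof. by have [w hw t] := weyl_to_triangle p; exists (w p); split=> //; exists w. Qed.

Definition fold p : plane := projT1 (cid (fold_subproof p)).

Lemma foldP p : triangle (fold p) /\ exists2 w, weyl w & fold p = w p.
Proof. by rewrite /fold; case: cid. Qed.

Lemma foldE p q : triangle q -> (exists2 w, weyl w & q = w p) -> q = fold p.
Proof.
by move=> tq [w hw e]; have [tf [w' hw' e']] := foldP p; exact: fold_unique hw hw' e e' tq tf.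
Qed.

Lemma fold_weyl w p : weyl w -> fold (w p) = fold p.
Proof.
move=> hw; apply: foldE; first exact: (foldP _).1.
have [_ [w' hw' ->]] := foldP (w p).
by exists (w' \o w) => //; apply: weyl_comp.
Qed.

Lemma fold_id p : triangle p -> fold p = p.
Proof. by move=> tp; apply/esym/foldE => //; exists id => //; exact: weyl_id. Qed.

Lemma fold_relabel sg p : fold (relabel sg p) = relabel sg (fold p).
Proof.
apply/esym/foldE; first by apply/relabel_triangle; exact: (foldP p).1.
have [_ [w hw ->]] := foldP p; have [w' hw' E] := relabel_weyl sg hw.
by exists w' => //; have /(congr1 (fun k => k p)) := E.
Qed.

Lemma boundary_fold p : boundary (fold p) <-> on_wall p.
Proof.
have [tf [w hw e]] := foldP p.
by rewrite (boundaryP tf) e (on_wall_weyl _ hw).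
Qed.

Lemma folds_fold f P v : folds f P v -> f = (fun t => fold (P + t *: v)).
Proof. by case=> _ _ h; apply/funext => t; apply: foldE; have [] := h t. Qed.

(** The line through P in direction V is the unfolding of a nonsingular path. *)
Definition avoids P V : Prop := V <> 0 /\ forall t, ~ tess_vertex (P + t *: V).

Lemma fold_folds P V : avoids P V -> folds (fun t => fold (P + t *: V)) P V.
Proof. by case=> h1 h2; split=> // t; exact: foldP. Qed.

(** Folding the segment from P to P + V at unit duration.  Up to speed and initial
    point every periodic orbit has this form, so orbits reduce to pairs (P, V). *)
Definition line_orbit P V : billiard_orbit R :=
  BilliardOrbit (fun t => fold (P + t *: V)) 0 1.

(** The motion repeats after time 1 iff the segments starting at P and at P + V
    have the same folding, that is, iff a group element carries (P, V) to
    (P + V, V). *)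
Lemma line_orbit_periodic P V : avoids P V ->
  periodic_orbit (line_orbit P V) <-> exists2 w, weyl w & P + V = w P /\ lin w V = V.
Proof.
move=> av; have hf := fold_folds av; split=> [[_ _ /= per]|[w hw [e1 e2]]].
  have hf' : folds (fun t => fold (P + t *: V)) (P + V) V.
    have E t : P + V + t *: V = P + (1 + t) *: V by rewrite -addrA scalerDl scale1r.
    split; first exact: av.1.
      by move=> t; rewrite E; exact: av.2.
    move=> t; split; first exact: (foldP _).1.
    by have := per t; rewrite add0r => ->; rewrite E; exact: (foldP _).2.
  by have [w hw [e1 e2]] := folds_change hf hf'; exists w.
split=> /=; [exact: folds_nonsingular hf|exact: ltr01|move=> t].
have [mw _] := weyl_motion hw.
by rewrite add0r scalerDl scale1r addrA e1 -{2}e2 -mw (fold_weyl _ hw).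
Qed.

Lemma same_orbit_refl a : same_orbit a a.
Proof.
exists (relabel 1%g), 1, 0; split; [exact: relabel_symmetry|exact: oner_neq0| |].
  by move=> t; rewrite relabel1 mul1r addr0.
by rewrite normr1 mul1r.
Qed.

Lemma same_orbit_sym a b : same_orbit a b -> same_orbit b a.
Proof.
case=> g [c [d [/symmetry_relabel[s ->] c0 h1 h2]]].
exists (relabel s^-1%g), c^-1, (- (d / c)); split.
- exact: relabel_symmetry.
- by rewrite invr_eq0.
- move=> t; rewrite h1 relabelM mulgV relabel1; congr (traj a _).
  by field.
- by rewrite -h2 mulrA normfV mulVf ?mul1r // normr_eq0.
Qed.

Lemma same_orbit_trans b a a' : same_orbit a b -> same_orbit b a' -> same_orbit a a'.
Proof.
case=> g [c [d [/symmetry_relabel[s ->] c0 h1 h2]]].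
case=> g' [c' [d' [/symmetry_relabel[s' ->] c0' h1' h2']]].
exists (relabel (s * s')%g), (c * c'), (c * d' + d); split.
- exact: relabel_symmetry.
- by rewrite mulf_neq0.
- by move=> t; rewrite h1' h1 relabelM; congr (relabel _ (traj a _)); lra.
- by rewrite normrM -mulrA h2' h2.
Qed.

Lemma same_orbit_iterate a b n : same_orbit a b -> same_orbit (iterate a n) (iterate b n).
Proof.
case=> g [c [d [hg c0 h1 h2]]]; exists g, c, d; split=> //=.
by rewrite [start b + _]addrC [start a + _]addrC !addrK mulrCA h2.
Qed.

Lemma periodic_folds a : periodic_orbit a -> exists P V, folds (traj a) P V.
Proof.
case=> hn _ _; have [c c0 /(_ (start a))[_ _ [u [v [_ dv _ _ _]]]]] := hn.
by exists (traj a (start a) - start a *: v), v; exact: nonsingular_folds.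
Qed.

Lemma folds_same f P v sg (c d : R) : folds f P v -> c != 0 ->
  folds (fun t => relabel sg (f (c * t + d))) (relabel sg (P + d *: v)) (c *: lin (relabel sg) v).
Proof.
move=> hf c0; have [v0 nv _] := hf; have hs := relabel_motion R sg.
have E t : relabel sg (P + d *: v) + t *: (c *: lin (relabel sg) v) =
    relabel sg (P + (c * t + d) *: v).
  by rewrite scalerA -hs.1 -addrA -scalerDl; congr (relabel _ (_ + _ *: _)); lra.
split.
- by move/eqP; rewrite scaler_eq0 (negbTE c0) => /eqP; exact: lin_neq0.
- move=> t; rewrite E => /(relabel_tess sg^-1%g); rewrite relabelM mulgV relabel1.
  exact: nv.
- move=> t; rewrite E (folds_fold hf) -fold_relabel; exact: foldP.
Qed.

Lemma periodic_shift a : periodic_orbit a ->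
  (forall t, traj a (t + (stop a - start a)) = traj a t) /\
  (forall t, traj a (t - (stop a - start a)) = traj a t).
Proof.
case=> _ _ h; split=> t.
  have := h (t - start a); rewrite addrC subrK => ->; congr (traj a _); lra.
have := h (t - stop a); rewrite [stop a + _]addrC subrK => <-; congr (traj a _); lra.
Qed.

Lemma same_orbit_periodic a b : same_orbit a b -> periodic_orbit a -> periodic_orbit b.
Proof.
case=> g [c [d [/symmetry_relabel[s ->] c0 h1 h2]]] pa.
have [P [V hf]] := periodic_folds pa; have [_ lt _] := pa.
have cp : 0 < `|c| by rewrite normr_gt0.
split.
- have := folds_nonsingular (folds_same s d hf c0).
  by congr nonsingular_trajectory; apply/funext => t; rewrite h1.
- by move: lt; rewrite -subr_gt0 -h2 pmulr_rgt0 // subr_gt0.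
- move=> t; rewrite !h1; congr (relabel _ _); have [sh1 sh2] := periodic_shift pa.
  have [cge|clt] := leP 0 c.
    by rewrite -sh1 -h2 ger0_norm //; congr (traj a _); lra.
  by rewrite -sh2 -h2 ltr0_norm //; congr (traj a _); lra.
Qed.

End FoldedLines.

(** * Normalized orbits *)

Section Normalization.
Variable R : realType.
Local Notation plane := (plane R).
Implicit Types (p q r u v d P V : plane) (i j : 'I_3) (h w g : plane -> plane)
  (f : R -> plane) (s t : R) (a b : billiard_orbit R).

(** For c = cos (pi / 3), the addition formulas for cos pi = -1 give
    (c + 1) (2 c - 1)^2 = 0, and c > 0. *)
Lemma cos_pi3 : cos (pi / 3) = 1 / 2 :> R.
Proof.
have p0 := pi_gt0 R.
set c := cos (pi / 3).
have c0 : 0 < c by apply: cos_gt0_pihalf; apply/andP; split; lra.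
have s1 := cos2Dsin2 (pi / 3 : R); rewrite -/c in s1.
have c2 : cos (pi / 3 + pi / 3) = c ^+ 2 - sin (pi / 3) ^+ 2 :> R by rewrite cosD -!expr2.
have s2 : sin (pi / 3 + pi / 3) = 2 * sin (pi / 3) * c :> R by rewrite sinD -/c; lra.
have c3 : cos (pi / 3 + pi / 3 + pi / 3) = -1 :> R.
  by rewrite -cospi; congr cos; lra.
move: c3; rewrite cosD c2 s2 -/c => c3.
have e : (c + 1) * (2 * c - 1) ^+ 2 = 0 by nra.
move/eqP: e; rewrite mulf_eq0 sqrf_eq0 => /orP[/eqP|/eqP]; lra.
Qed.

Lemma cos_pi6 : cos (pi / 6) = Num.sqrt 3 / 2 :> R.
Proof.
have p0 := pi_gt0 R.
set c := cos (pi / 6).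
have c0 : 0 < c by apply: cos_gt0_pihalf; apply/andP; split; lra.
have s1 := cos2Dsin2 (pi / 6 : R); rewrite -/c in s1.
have c2 : cos (pi / 6 + pi / 6) = c ^+ 2 - sin (pi / 6) ^+ 2 :> R by rewrite cosD -!expr2.
have e : cos (pi / 6 + pi / 6) = 1 / 2 :> R by rewrite -cos_pi3; congr cos; lra.
have s0 := sqrt3_gt0 R; have s3 := sqrt3_sq R.
have : (c - Num.sqrt 3 / 2) * (c + Num.sqrt 3 / 2) = 0.
  by rewrite -subr_sqr exprMn s3; lra.
by move/eqP; rewrite mulf_eq0 => /orP[]/eqP; lra.
Qed.

Lemma acos_between (c : R) : 0 <= c <= 1 ->
  (pi / 6 <= acos c <= pi / 3) = (1 / 2 <= c <= Num.sqrt 3 / 2).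
Proof.
move=> /andP[c0 c1]; have p0 := pi_gt0 R.
have [|/andP[a0 a1] ac] := @acos_def R c; first by lra.
have I (x : R) : 0 <= x -> x <= pi -> x \in `[0, pi] by move=> *; rewrite in_itv /=; apply/andP.
rewrite -{3 4}ac -cos_pi3 -cos_pi6 andbC !leNgt !ltr_cos //; apply: I; lra.
Qed.

Lemma dot_e1 v : dot v e1 = v.1.
Proof. by rewrite /dot /= mulr1 mulr0 addr0. Qed.

Lemma fst_rxyE v : v.1 = rx v + ry v / 2 :> R.
Proof. by rewrite -dot_e1 dot_rxyE !rxyE; lra. Qed.

Lemma snd_gt0 v : (0 < v.2) = (0 < ry v).
Proof.
have s0 := sqrt3_gt0 R.
by rewrite /ry -mulrA pmulr_rgt0 // pmulr_lgt0 // invr_gt0.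
Qed.

(** With x = rx v and y = ry v, squaring the bounds 1 / 2 and sqrt 3 / 2 on the
    cosine gives 0 <= x (x + y) and (x - y) (x + 2 y) <= 0. *)
Lemma sector_angle v : 0 < v.1 -> 0 < v.2 ->
  (pi / 6 <= line_angle v (ptC - ptB) <= pi / 3) = (0 <= rx v <= ry v).
Proof.
rewrite snd_gt0 fst_rxyE => h1 h2.
have s0 := sqrt3_gt0 R; have s3 := sqrt3_sq R.
have -> : ptC - ptB = e1 :> plane by rewrite /ptB subr0.
have n1 : enorm (e1 : plane) = 1.
  by rewrite /enorm dot_rxyE !rxyE -[RHS]sqrtr1; congr Num.sqrt; lra.
have vn0 : v <> 0 by move=> v0; move: h2; rewrite v0 ry0 ltxx.
have n0 := enorm_gt0 vn0; have n2 := enorm_sq v; rewrite dot_rxyE in n2.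
rewrite /line_angle n1 mulr1 dot_e1 fst_rxyE gtr0_norm //.
move: (enorm v) n0 n2 => n n0 n2; move: (rx v) (ry v) h1 h2 n2 => x y h1 h2 n2.
have {}n2 : n ^+ 2 = x * x + y * y + x * y by rewrite n2; lra.
rewrite acos_between; last first.
  apply/andP; split; first by apply: divr_ge0; apply: ltW.
  rewrite ler_pdivrMr // mul1r.
  by rewrite -(@ler_pXn2r _ 2) ?nnegrE ?ltW // n2; nra.
rewrite ler_pdivlMr // ler_pdivrMr //.
have -> : (1 / 2 * n <= x + y / 2) = (n ^+ 2 <= (2 * x + y) ^+ 2).
  rewrite ler_pXn2r ?nnegrE //; [|exact: ltW|lra].
  by apply/idP/idP; lra.
have -> : (x + y / 2 <= Num.sqrt 3 / 2 * n) = ((2 * x + y) ^+ 2 <= (Num.sqrt 3 * n) ^+ 2).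
  rewrite ler_pXn2r ?nnegrE //; [|lra|by rewrite mulr_ge0 // ltW].
  by apply/idP/idP; lra.
rewrite exprMn s3 n2; apply/idP/idP => /andP[l1 l2]; apply/andP; split; nra.
Qed.

Lemma dot_reflect_dir d u : d <> 0 -> dot (reflect_dir d u) d = dot u d.
Proof.
move/dot_gt0 => d0; rewrite /reflect_dir dotDl dotZl dotNl mulfVK ?gt_eqF //. by lra.
Qed.

Lemma line_angle_reflect i u :
  line_angle (reflect_dir (side_dir i) u) (side_dir i) = line_angle u (side_dir i).
Proof.
rewrite /line_angle /enorm reflect_dir_dot dot_reflect_dir // => d0.
have [_ _] := side_edge R i; rewrite -opprB -/(side_dir i) d0 oppr0 /enorm dot_rxyE !rxyE.
by rewrite !mulr0 !addr0 mul0r addr0 sqrtr0 => /eqP; rewrite eq_sym oner_eq0.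
Qed.

Lemma segment_BC p : segment ptB ptC p <-> ry p = 0 /\ 0 <= rx p <= 1.
Proof.
rewrite segmentP; split=> [[t t01 ->]|[h1 h2]].
  by rewrite /ptB /ptC !rxyE; split; lra.
by exists (rx p) => //; apply: rxy_inj; rewrite /ptB /ptC !rxyE; lra.
Qed.

Lemma side0_BC p : side 0 p <-> ry p = 0 /\ 0 <= rx p <= 1.
Proof. by rewrite -segment_BC /side !ord3E vertex1 vertex2. Qed.

(** The pairs (P, V) given by normalized orbits: P lies on the base BC, and the
    inclination of V lies in [30, 60] degrees. *)
Definition sector_line P V : Prop :=
  [/\ ry P = 0, 0 <= rx P <= 1, 0 <= rx V <= ry V & avoids P V].

Lemma sector_line_ry_gt0 P V : sector_line P V -> 0 < ry V.
Proof.
case=> _ _ /andP[x0 xy] [v0 _]; rewrite lt_neqAle (le_trans x0 xy) andbT.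
apply/eqP => y0; apply: v0; apply: rxy_inj; rewrite ?rxyE; lra.
Qed.

Lemma sector_line_triangle P V : sector_line P V -> triangle P.
Proof. by case=> h1 h2 _ _; apply/triangle_rxyP; rewrite h1; split; lra. Qed.

Lemma line_orbit_start P V : triangle P -> traj (line_orbit P V) 0 = P.
Proof. by move=> tP; rewrite /= scale0r addr0 fold_id. Qed.

Lemma line_orbit_departs P V : sector_line P V -> departs (traj (line_orbit P V)) 0 V.
Proof.
move=> gP; have yV := sector_line_ry_gt0 gP; have tP := sector_line_triangle gP.
case: (gP) => h1 h2 h3 av.
have hf := fold_folds av.
have e : fold (P + 0 *: V) = id (P + 0 *: V).
  by rewrite scale0r addr0 fold_id.
have [e0 ep [h|[i [bi _]]]] := folds_right hf (weyl_id R) e.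
  by exists e0 => // s /h; rewrite lin_id.
rewrite /= scale0r addr0 fold_id // lin_id in bi *.
(* V points upwards, so the path cannot leave through the base, and the other
   sides meet the base in vertices only. *)
have nP : ~ tess_vertex P by have := av.2 0; rewrite scale0r addr0.
have i0 : i = 0.
  apply/eqP/negPn/negP => i0; apply: nP; apply: (two_sides_vertex i0 bi).
  by rewrite /bary.
by rewrite i0 /bary /= !rxyE; lra.
Qed.

Lemma sector_line_normalized P V : sector_line P V -> normalized (line_orbit P V).
Proof.
move=> gP; have yV := sector_line_ry_gt0 gP; have tP := sector_line_triangle gP.
have dV := line_orbit_departs gP.
case: (gP) => h1 h2 h3 av.
rewrite /normalized line_orbit_start //; split; first by apply/segment_BC.
have [c c0 /(_ 0)[_ _ [u [v [au dv _ _ hs]]]]] := folds_nonsingular (fold_folds av).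
have ev := departs_unique dV dv; subst v.
exists u, V; split=> //; last by rewrite fst_rxyE snd_gt0; split; lra.
have eV : V = reflect_dir (side_dir 0) u.
  by apply: hs; rewrite scale0r addr0 fold_id //; apply/side0_BC.
have d0 : side_dir 0 = ptC - ptB :> plane by rewrite /side_dir !ord3E vertex1 vertex2.
have -> : line_angle u (ptC - ptB) = line_angle V (ptC - ptB).
  by rewrite eV -d0 line_angle_reflect.
by rewrite sector_angle ?snd_gt0 // fst_rxyE; lra.
Qed.

(** The law of reflection does not change the angle with the base, so the angle
    of incidence bounds the direction of departure. *)
Lemma normalized_sector_line a : periodic_orbit a -> normalized a -> exists v,
  [/\ sector_line (traj a (start a)) ((stop a - start a) *: v), departs (traj a) (start a) v &
    same_orbit a (line_orbit (traj a (start a)) ((stop a - start a) *: v))].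
Proof.
move=> pa [/segment_BC[y0 x01] [u [v [au dv ang [v1 v2]]]]].
have [hn lt _] := pa; have hf := nonsingular_folds hn dv.
have T0 : 0 < stop a - start a by lra.
set P := traj a (start a) in y0 x01 hf *; set T := stop a - start a in T0 *.
have E t : P - start a *: v + t *: v = P + (t - start a) *: v.
  by rewrite -addrA -scaleNr -scalerDl; congr (_ + _ *: _); lra.
have hP : avoids P (T *: v).
  split.
    by move/eqP; rewrite scaler_eq0 gt_eqF //= => /eqP; case: hf.
  move=> t; rewrite scalerA; have [_ nv _] := hf.
  by have := nv (t * T + start a); rewrite E addrK.
exists v; split=> //.
  split=> //; rewrite !rxyE.
  have [c c0 /(_ (start a))[_ _ [u' [v' [au' dv' _ _ hs]]]]] := hn.
  have ev := departs_unique dv dv'; subst v'.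
  have eu := arrives_unique au au'; subst u'.
  have eV : v = reflect_dir (side_dir 0) u by apply: hs; apply/side0_BC.
  have d0 : side_dir 0 = ptC - ptB :> plane by rewrite /side_dir !ord3E vertex1 vertex2.
  have eA : line_angle u (ptC - ptB) = line_angle v (ptC - ptB).
    by rewrite eV -d0 line_angle_reflect.
  by move: ang; rewrite eA sector_angle // => /andP[x0 xy]; rewrite mulr_ge0 ?(ltW T0) //= ler_pM2l.
exists (relabel 1%g), T, (start a); split.
- exact: relabel_symmetry.
- by rewrite gt_eqF.
- move=> t /=; rewrite relabel1 (folds_fold hf) E addrK scalerA.
  by rewrite mulrC.
- by rewrite /= subr0 mulr1 gtr0_norm.
Qed.

(** Apply a symmetry of the tessellation that brings the direction into the
    sector.  The resulting line is not horizontal, so it meets the line that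
    carries the base, and an integer translation brings that point into BC.  The relabelling
    part of the symmetry and the time of the crossing identify the two orbits. *)
Lemma normalize a : periodic_orbit a -> exists P V,
  sector_line P V /\ same_orbit a (line_orbit P V).
Proof.
move=> pa; have [P0 [v hf]] := periodic_folds pa.
have [_ lt _] := pa; have [v0 nv _] := hf.
have T0 : 0 < stop a - start a by lra.
set T := stop a - start a in T0 *.
have [h0 hl0 sec] := sector_exists v.
have mh0 := latsym_motion hl0.
have v0' : lin h0 v <> 0 by exact: lin_neq0.
have y0 : 0 < ry (lin h0 v).
  move: sec => /andP[x0 xy]; rewrite lt_neqAle (le_trans x0 xy) andbT.
  apply/eqP => y0; apply: v0'; apply: rxy_inj; rewrite ?rx0 ?ry0; lra.
(* The time at which the line meets ry = 0, and the edge in which it does. *)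
pose t1 := - ry (h0 P0) / ry (lin h0 v).
pose m := Num.floor (rx (h0 (P0 + t1 *: v))).
have hl : latsym ((fun p => rhombic p (- m)%:~R 0%:~R) \o h0).
  by apply: latsym_comp => //; exact: latsym_translation.
set h := _ \o _ in hl.
have mh := latsym_motion hl.
have lh : lin h v = lin h0 v.
  by rewrite /lin /h /=; apply: rxy_inj; rewrite !rxyE ?(rx_rhombic, ry_rhombic) ?rxyE; lra.
have E t : h (P0 + t1 *: v) + t *: (T *: lin h v) = h (P0 + (T * t + t1) *: v).
  by rewrite scalerA -mh.1 -addrA -scalerDl; congr (h (_ + _ *: _)); lra.
exists (h (P0 + t1 *: v)), (T *: lin h v); split.
  split.
  - rewrite /h /= ry_rhombic addr0 mh0.1 ryD ryZ /t1 mulfVK ?gt_eqF // subrr //.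
  - have /andP[f0 f1] := floor_itv (rx (h0 (P0 + t1 *: v))).
    by rewrite /h /= rx_rhombic intrN -/m; move: f1; rewrite intrD -/m; move: f0; rewrite -/m; lra.
  - by rewrite lh rxZ ryZ; move: sec => /andP[x0 xy]; rewrite mulr_ge0 ?(ltW T0) //= ler_pM2l.
  - split.
      by move/eqP; rewrite scaler_eq0 gt_eqF //= => /eqP; rewrite lh.
    move=> t; rewrite E; have [h' [hl' k1 k2]] := latsym_inv hl.
    by move/(latsym_tess hl'); rewrite k1; exact: nv.
have [s0 [w hw eh]] := hl.
exists (relabel s0), T, t1; split.
- exact: relabel_symmetry.
- by rewrite gt_eqF.
- move=> t /=; rewrite E (folds_fold hf) -fold_relabel eh /= fold_relabel fold_weyl // fold_relabel.
  done.
- by rewrite /= subr0 mulr1 gtr0_norm.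
Qed.

End Normalization.

(** * Periods of normalized orbits *)

Section Counting.
Variable R : realType.
Local Notation plane := (plane R).
Implicit Types (p q r u v d P V : plane) (h w g : plane -> plane)
  (f : R -> plane) (s t : R) (a b : billiard_orbit R).

Lemma card_uniq_seq (T : choiceType) (s : seq T) :
  uniq s -> ([set x | x \in s] #= `I_(size s))%card.
Proof.
move=> us; case: s us => [|x0 s] us.
  by rewrite (_ : [set x | _] = set0) ?II0 // -subset0 => x.
set l := x0 :: s; rewrite card_eq_sym.
have -> : [set x | x \in l] = [set nth x0 l i | i in `I_(size l)].
  apply/seteqP; split=> x /=; first by move=> /(nthP x0)[i hi <-]; exists i.
  by case=> i hi <-; exact: mem_nth.
rewrite card_eq_sym; apply: inj_card_eq => i j; rewrite !inE => hi hj /eqP.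
by rewrite nth_uniq // => /eqP.
Qed.

Lemma card_eq_II_inj (T : Type) (A : set T) m n : (A #= `I_m)%card -> (A #= `I_n)%card -> m = n.
Proof. by move=> /card_esym h1 h2; apply/card_eq_II; exact: card_eq_trans h1 h2. Qed.

(** The times at which a uniformly moving coordinate is an integer: over one unit
    of time a half-open interval of length N is covered, which contains N
    integers.  For N = 0 the constant value c must not be an integer. *)
Lemma integer_times (c : R) (N : nat) : -1 < c <= 0 -> (c < 0 \/ (0 < N)%N) ->
  exists l : seq R, [/\ uniq l, size l = N & forall t,
    t \in l <-> 0 <= t < 1 /\ exists k : int, c + N%:R * t = k%:~R].
Proof.
move=> /andP[c1 c0] hN; exists [seq (j%:R - c) / N%:R | j <- iota 0 N].
have [N0|N0] := posnP N.
  rewrite N0 /=; split=> // t; split=> // -[_ [k]].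
  rewrite mul0r addr0 => ck; case: hN => [c0'|]; last by rewrite N0.
  have : -1 < k by rewrite -(ltr_int R) -ck.
  have : k < 0 by rewrite -(ltr_int R) -ck.
  by lia.
have NR : 0 < N%:R :> R by rewrite ltr0n.
have Nn : N%:R != 0 :> R by rewrite gt_eqF.
split.
- rewrite map_inj_uniq ?iota_uniq // => i j /(mulIf (invr_neq0 Nn)) /addIr /eqP.
  by rewrite eqr_nat => /eqP.
- by rewrite size_map size_iota.
- move=> t; split=> [/mapP[j]|[/andP[t0 t1] [k ek]]].
    rewrite mem_iota add0n => /andP[_ jN] ->.
    have jN' : j%:R + 1 <= N%:R :> R by rewrite natr1 ler_nat.
    have j0 : 0 <= j%:R :> R by rewrite ler0n.
    split; last by exists j; rewrite mulrC divfK //; lra.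
    by rewrite ler_pdivlMr // ltr_pdivrMr // mul0r mul1r; apply/andP; split; lra.
  have Nt : 0 <= N%:R * t by rewrite mulr_ge0.
  have Nt1 : N%:R * t < N%:R by rewrite -[ltRHS]mulr1 ltr_pM2l.
  have k1 : -1 < k by rewrite -(ltr_int R) -ek; lra.
  have kN : k < N%:Z by rewrite -(ltr_int R) -ek -[X in _ < X]/(N%:R); lra.
  case: k ek k1 kN => // j ek _ jN.
  apply/mapP; exists j; first by rewrite mem_iota add0n.
  have -> : j%:R - c = N%:R * t by rewrite -[j%:R]ek; lra.
  by rewrite mulrC mulKf.
Qed.

Lemma line_orbit_strikes P V t :
  strike_times (line_orbit P V) t <-> 0 <= t < 1 /\ on_wall (P + t *: V).
Proof. by rewrite /strike_times /= boundary_fold. Qed.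

Lemma sector_line_rx P V : sector_line P V -> 0 < rx P < 1.
Proof.
case=> y0 /andP[x0 x1] _ [_ /(_ 0)]; rewrite scale0r addr0 => nv.
rewrite !lt_neqAle x0 x1 !andbT; apply/andP; split; apply/eqP => e; apply: nv;
  apply/tess_vertexP; [exists 0, 0|exists 1, 0]; by rewrite y0 -?e ?e.
Qed.

Lemma on_wall_rxyP p : on_wall p <-> [\/ exists k : int, rx p = k%:~R,
  exists k : int, ry p = k%:~R | exists k : int, rx p + ry p = k%:~R].
Proof.
split=> [[i [k]]|].
  elim/ord3_cases: i; rewrite /bary /= => e.
  - by constructor 2; exists k.
  - by constructor 3; exists (1 - k); rewrite intrB; lra.
  - by constructor 1; exists k.
case=> -[k e].
- by exists 2%:R, k.
- by exists 0, k.
- by exists 1, (1 - k); rewrite /bary /= intrB; lra.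
Qed.

(** Along V the coordinates ry, rx and rx + ry increase by y, x and x + y, so the
    path crosses that many lines of the three families; the crossings are at
    different times because no vertex is met. *)
Lemma even_count P V (x y : nat) : sector_line P V -> rx V = x%:R -> ry V = y%:R ->
  has_period (line_orbit P V) (2 * (x + y)).
Proof.
move=> gP ex ey; have /andP[x0 x1] := sector_line_rx gP; have y0 := sector_line_ry_gt0 gP.
case: (gP) => yP _ _ [_ nv].
have Y0 : (0 < y)%N by rewrite -(ltr0n R) -ey.
have [l1 [u1 s1 m1]] : exists l : seq R, [/\ uniq l, size l = y & forall t,
    t \in l <-> 0 <= t < 1 /\ exists k : int, 0 + y%:R * t = k%:~R].
  by apply: integer_times; [lra|right].
(* rx starts in ]0, 1[; the shift by 1 puts the start into ]-1, 0]. *)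
have [l2 [u2 s2 m2]] := @integer_times (rx P - 1) x ltac:(lra) ltac:(left; lra).
have [l3 [u3 s3 m3]] := @integer_times (rx P - 1) (x + y) ltac:(lra) ltac:(left; lra).
have rxt t : rx (P + t *: V) = rx P + x%:R * t by rewrite !rxyE ex mulrC.
have ryt t : ry (P + t *: V) = y%:R * t by rewrite !rxyE yP ey add0r mulrC.
have nat_D : (x + y)%:R = x%:R + y%:R :> R by rewrite natrD.
have nv2 t (k l : int) : rx P + x%:R * t = k%:~R -> y%:R * t = l%:~R -> False.
  by move=> e1 e2; apply: (nv t); apply/tess_vertexP; exists k, l; rewrite rxt ryt.
have M1 t : t \in l1 -> exists k : int, y%:R * t = k%:~R.
  by case/m1 => _ [k]; rewrite add0r => e; exists k.
have M2 t : t \in l2 -> exists k : int, rx P + x%:R * t = k%:~R.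
  by case/m2 => _ [k e]; exists (k + 1); rewrite intrD; lra.
have M3 t : t \in l3 -> exists k : int, rx P + x%:R * t + y%:R * t = k%:~R.
  by case/m3 => _ [k]; rewrite nat_D => e; exists (k + 1); rewrite intrD; lra.
have ul : uniq (l1 ++ l2 ++ l3).
  rewrite !cat_uniq u1 u2 u3 !andbT /=; apply/andP; split.
    apply/hasPn => t; rewrite mem_cat => /orP[/M2[k e]|/M3[k e]]; apply/negP => /M1[l e'].
      exact: nv2 e e'.
    by apply: (nv2 t (k - l) l) => //; rewrite intrB; lra.
  apply/hasPn => t /M3[k e]; apply/negP => /M2[l e'].
  by apply: (nv2 t l (k - l)) => //; rewrite intrB; lra.
have -> : (2 * (x + y))%N = size (l1 ++ l2 ++ l3) by rewrite !size_cat s1 s2 s3; lia.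
rewrite /has_period (_ : strike_times _ = [set t | t \in l1 ++ l2 ++ l3]);
  first exact: card_uniq_seq.
apply/seteqP; split=> t.
  move/line_orbit_strikes => [t01 /on_wall_rxyP]; rewrite rxt ryt => H /=.
  rewrite !mem_cat; apply/or3P; case: H => -[k e].
  - by constructor 2; apply/m2; split=> //; exists (k - 1); rewrite intrB; lra.
  - by constructor 1; apply/m1; split=> //; exists k; rewrite add0r.
  - by constructor 3; apply/m3; split=> //; exists (k - 1); rewrite intrB nat_D; lra.
rewrite /= !mem_cat => H; apply/line_orbit_strikes; split.
  by case/or3P: H => [/m1[]|/m2[]|/m3[]].
apply/on_wall_rxyP; rewrite rxt ryt; case/or3P: H => [/M1|/M2|/M3] h.
- by constructor 2. - by constructor 1. - by constructor 3.
Qed.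

(** On the line rx = 1 / 2 the lines of the other two families are met at the
    integer and at the half-integer heights ry, respectively. *)
Lemma odd_count P V (n : nat) : sector_line P V -> rx P = 1 / 2 -> rx V = 0 -> ry V = n%:R / 2 ->
  has_period (line_orbit P V) n.
Proof.
move=> gP eP ex ey; have y0 := sector_line_ry_gt0 gP; case: (gP) => yP _ _ _.
have n0 : (0 < n)%N by rewrite -(ltr0n R); lra.
have [l [ul sl ml]] : exists l : seq R, [/\ uniq l, size l = n & forall t,
    t \in l <-> 0 <= t < 1 /\ exists k : int, 0 + n%:R * t = k%:~R].
  by apply: integer_times; [lra|right].
have rxt t : rx (P + t *: V) = 1 / 2 by rewrite !rxyE ex eP; lra.
have ryt t : ry (P + t *: V) = n%:R * t / 2 by rewrite !rxyE yP ey; lra.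
rewrite /has_period -sl (_ : strike_times _ = [set t | t \in l]); first exact: card_uniq_seq.
have half (k : int) : k%:~R + k%:~R <> 1 :> R.
  by rewrite -intrD -[1]/(1%:~R) => /intr_inj; lia.
apply/seteqP; split=> t.
  move/line_orbit_strikes => [t01 /on_wall_rxyP]; rewrite rxt ryt => H /=.
  apply/ml; split=> //; case: H => -[k e].
  - by case: (half k); lra.
  - by exists (2 * k); rewrite intrM; lra.
  - by exists (2 * k - 1); rewrite intrB intrM; lra.
move=> /ml[t01 [k e]]; apply/line_orbit_strikes; split=> //.
apply/on_wall_rxyP; rewrite rxt ryt.
have [[l' e']|[l' e']] : (exists l' : int, k = 2 * l') \/ exists l' : int, k = 2 * l' + 1.
  have := divz_eq k 2; have : (0 <= (k %% 2)%Z < 2) by lia.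
  move=> h1 h2; have [h|h] : (k %% 2)%Z = 0 \/ (k %% 2)%Z = 1 by lia.
    by left; exists (k %/ 2)%Z; lia.
  by right; exists (k %/ 2)%Z; lia.
- by constructor 2; exists l'; move: e; rewrite e' intrM; lra.
- by constructor 3; exists (l' + 1); move: e; rewrite e' !intrD intrM; lra.
Qed.

(** The translation vectors of the Weyl group in the first quadrant. *)
Definition even_vector V := exists x y : nat,
  [/\ rx V = x%:R, ry V = y%:R & exists k : int, y%:Z = x%:Z + 3 * k].

(** The group element that carries (P, V) to (P + V, V) fixes the direction V.
    It is not a rotation.  If it is a translation, V is in the lattice.  If it is
    a glide reflection, V is along its axis; in the sector this leaves only axes
    of inclination 60 degrees, and among these the midline rx = 1 / 2, because
    P is an inner point of the base.  This is the path of the Fagnano orbit. *)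
Lemma periodic_line_cases P V : sector_line P V -> periodic_orbit (line_orbit P V) ->
  even_vector V \/
  [/\ rx P = 1 / 2, rx V = 0 & exists k : nat, ry V = (3 * (2 * k + 1))%:R / 2].
Proof.
move=> gP; have y0 := sector_line_ry_gt0 gP; have /andP[p0 p1] := sector_line_rx gP.
case: (gP) => yP _ /andP[xV xyV] av.
case/(line_orbit_periodic av) => w /weyl_form[j [m [k [j6 hw]]]] [e1 e2].
have [a1 a2] := hw P; have [b1 b2] := hw V; have [c1 c2] := hw 0.
have := (congr1 (@rx R) e1, congr1 (@ry R) e1); rewrite rxD ryD yP add0r => -[f1 f2].
have g1 : rx V = rx (w V) - rx (w 0) by rewrite -{1}e2 /lin rxD rxN.
have g2 : ry V = ry (w V) - ry (w 0) by rewrite -{1}e2 /lin ryD ryN.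
rewrite a1 yP in f1; rewrite a2 yP in f2; rewrite b1 c1 rx0 ry0 in g1; rewrite b2 c2 rx0 ry0 in g2.
rewrite /even_vector.
move: (rx P) (rx V) (ry V) y0 p0 p1 xV xyV f1 f2 g1 g2 {a1 a2 b1 b2 c1 c2 e1 e2 yP av hw gP}.
move=> p x y y0 p0 p1 xV xyV.
move: j j6 => [|[|[|[|[|[|//]]]]]] _ /= f1 f2 g1 g2; try lra.
- left; have ex : x = m%:~R by lra. have ey : y = (m + 3 * k)%:~R by lra.
  have m0 : 0 <= m by rewrite -(ler_int R); lra.
  have n0 : 0 <= m + 3 * k by rewrite -(ler_int R); lra.
  exists (absz m), (absz (m + 3 * k)); split; last by exists k; rewrite !gez0_abs.
  + by rewrite natr_absz ger0_norm.
  + by rewrite natr_absz ger0_norm.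
- right; have ex : x = 0 by lra.
  have m1 : m = 1.
    have : 0 < m by rewrite -(ltr_int R); lra.
    have : m < 2 by rewrite -(ltr_int R); lra.
    by lia.
  move: f1 f2; rewrite m1 ex intrD intrM => f1 f2.
  have k0 : 0 <= k.
    have : -1 < k by rewrite -(ltr_int R); lra.
    by lia.
  split; [lra|done|exists (absz k)].
  have ek : (absz k)%:R = k%:~R :> R by rewrite natr_absz ger0_norm.
  by rewrite natrM natrD natrM ek; lra.
Qed.
End Counting.

(** * Unfoldings *)

Section Unfolding.
Variable R : realType.
Local Notation plane := (plane R).
Implicit Types (p q r u v d P Q V z : plane) (h w g : plane -> plane)
  (f : R -> plane) (t : R) (a b : billiard_orbit R) (s : nat -> R)
  (sigma : nat -> plane -> plane).

Lemma wall_segment (i : 'I_3) (c : R) p q z :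
  wall i p = c -> wall i q = c -> segment p q z -> wall i z = c.
Proof.
move=> hp hq /segmentP[t _ ->]; move: hp hq.
elim/ord3_cases: i; rewrite /wall /= !rxyE => hp hq.
- have -> : ry q = ry p by lra.
  by rewrite subrr mulr0 addr0.
- have e : rx q - rx p + (ry q - ry p) = 0 :> R by lra.
  by rewrite addrACA -mulrDr e mulr0 addr0.
- have -> : rx q = rx p by lra.
  by rewrite subrr mulr0 addr0.
Qed.

(** A point on two different lines of the tessellation is a vertex. *)
Lemma reflect_line_unique p q p' q' z : tess_edge p q -> tess_edge p' q' ->
  segment p q z -> segment p' q' z -> ~ tess_vertex z ->
  reflect_line p q = reflect_line p' q'.
Proof.
move=> /tess_edge_mirror[i [k [hp hq /funext ->]]] /tess_edge_mirror[i' [k' [hp' hq' /funext ->]]].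
move=> /(wall_segment hp hq) e /(wall_segment hp' hq') e' nv.
have [ii|ii] := eqVneq i i'.
  by subst i'; have -> : k = k' by (apply: (@intr_inj R); rewrite -e -e').
case: nv; apply/tess_vertexP; move: e e' ii {hp hq hp' hq'}.
elim/ord3_cases: i; elim/ord3_cases: i'; rewrite /wall //= => e e' _.
- by exists (k' - k), k; rewrite intrB; split; lra.
- by exists k', k.
- by exists (k - k'), k'; rewrite intrB; split; lra.
- by exists k', (k - k'); rewrite intrB; split; lra.
- by exists k, k'.
- by exists k, (k' - k); rewrite intrB; split; lra.
Qed.

(** The composed reflections carry the path to the line.  At a strike on side j,
    the next edge contains the point of impact on the line, as does the image of
    side j, so both give the same reflection; conjugating it back to the
    triangle yields the mirror in side j, which undoes the change of direction. *)
Lemma unfold_straight f n s sigma v : nonsingular_trajectory f ->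
  departs f (s 0%N) v ->
  (forall i, (i < n)%N -> s i < s i.+1) ->
  (forall i, (i <= n)%N -> boundary (f (s i))) ->
  (forall i t, (i < n)%N -> s i < t < s i.+1 -> ~ boundary (f t)) ->
  (forall i, (0 < i < n)%N ->
     compose sigma i.-1 (f (s i)) = f (s 0%N) + (s i - s 0%N) *: v ->
     exists p q, [/\ tess_edge p q, segment p q (f (s 0%N) + (s i - s 0%N) *: v) &
       sigma i = reflect_line p q]) ->
  forall i, (i < n)%N -> forall t, s i <= t <= s i.+1 ->
    compose sigma i (f t) = f (s 0%N) + (t - s 0%N) *: v.
Proof.
move=> hf d0 slt sb snb hsig.
pose c i := compose sigma i.
suff H i : (i < n)%N -> weyl (c i) /\ exists u, [/\ departs f (s i) u, lin (c i) u = v &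
    forall t, s i <= t <= s i.+1 -> c i (f t) = f (s 0%N) + (t - s 0%N) *: v].
  by move=> i /H[_ [u [_ _ h]]].
elim: i => [n0|i IH i1n].
  split; first exact: weyl_id.
  exists v; split=> // [|t ht]; first by rewrite lin_id.
  by apply: (straight_between_strikes hf d0 _ ht) => t' ht'; exact: snb ht'.
have {IH} [hw [u [du lu ht]]] := IH (ltnW i1n).
have mw := weyl_motion hw.
have l1 := slt _ (ltnW i1n).
have e1 : c i (f (s i.+1)) = f (s 0%N) + (s i.+1 - s 0%N) *: v.
  by apply: ht; rewrite lexx ltW.
have [p [q [epq sg es]]] := hsig i.+1 i1n e1.
have [j sj] := sb i.+1 (ltnW i1n).
have [c0 _ /(_ (s i.+1))[tf nvf [u' [v' [au dv _ _ hs]]]]] := hf.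
have au' : arrives f (s i.+1) u.
  exists (s i.+1 - s i) => [|t tt]; first by lra.
  have fu x : s i <= x <= s i.+1 -> f x = f (s i) + (x - s i) *: u.
    by apply: (straight_between_strikes hf du) => t' ht'; exact: (snb i t' (ltnW i1n) ht').
  rewrite (fu (s i.+1 - t)) ?(fu (s i.+1)); [|lra|lra].
  by rewrite -[in RHS]addrA -scaleNr -scalerDl; congr (_ + _ *: _); lra.
have eu := arrives_unique au au'; subst u'.
have ev := hs j sj.
have mj : motion (@side_mirror R j) by apply/weyl_motion/weyl_side_mirror.
have bj : bary j (f (s i.+1)) = 0 by case/sideP: sj.
have eC : c i.+1 = c i \o side_mirror j.
  apply/funext => r; transitivity (sigma i.+1 (c i r)) => //.
  rewrite es /comp /side_mirror (reflect_line_motion _ _ _ mw).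
  apply: (congr1 (fun g => g (c i r))).
  apply: (@reflect_line_unique _ _ _ _ (f (s 0%N) + (s i.+1 - s 0%N) *: v)) => //.
  - by apply: tess_edge_motion (side_edge R j) => //; exact: weyl_tess.
  - by rewrite -e1; apply: segment_motion.
  - rewrite -e1 weyl_tessE // => /(tess_triangle tf)[k]; exact: nvf.
split; first by rewrite eC; apply: weyl_comp => //; exact: weyl_side_mirror.
exists v'; split=> // [|t tt].
  rewrite eC (lin_comp _ _ mw) side_mirror_lin ev reflect_dirK //.
have -> : f t = f (s i.+1) + (t - s i.+1) *: v'.
  by apply: (straight_between_strikes hf dv _ tt) => t' ht'; exact: (snb i.+1 t' i1n ht').
rewrite eC /= (mj.1) side_mirror_fix // mw.1 e1 side_mirror_lin ev reflect_dirK lu.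
by rewrite -addrA -scalerDl; congr (_ + _ *: _); lra.
Qed.

Lemma successive_exists a : periodic_orbit a -> boundary (traj a (start a)) ->
  finite_set (strike_times a) -> exists n s, successive_strikes a n s.
Proof.
move=> pa b0 /finite_seqP[l0 el0]; have [_ lt per] := pa.
have b1 : boundary (traj a (stop a)) by have := per 0; rewrite !addr0 => <-.
pose l := sort <=%R (undup l0).
have lE t : t \in l <-> start a <= t < stop a /\ boundary (traj a t).
  rewrite /l mem_sort mem_undup -[_ /\ _]/(strike_times a t) el0. by [].
have sl : sorted <%R l.
  by rewrite lt_sorted_uniq_le sort_uniq undup_uniq sort_le_sorted.
(* With this default value the time after the last strike is the final one. *)
pose s i := nth (stop a) l i.
have slt i : (i.+1 < size l)%N -> s i < s i.+1.
  by move=> h; apply: (sorted_ltn_nth lt_trans) => //; rewrite inE // ltnW.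
have mono i j : (i < j)%N -> (j < size l)%N -> s i < s j.
  by move=> ij h; apply: (sorted_ltn_nth lt_trans) => //; rewrite inE // (ltn_trans ij).
have sin i : (i < size l)%N -> start a <= s i < stop a /\ boundary (traj a (s i)).
  by move=> h; apply/lE/mem_nth.
have sl0 : start a \in l by apply/lE; rewrite lexx.
have idx t : t \in l -> exists2 j, (j < size l)%N & s j = t.
  by move/(nthP (stop a)) => [j h e]; exists j.
have n0 : (0 < size l)%N by case: (l) sl0.
have s0 : s 0%N = start a.
  have [j jn ej] := idx _ sl0; case: j jn ej => // j jn ej.
  have := mono 0%N j.+1 isT jn; have [/andP[h _] _] := sin _ n0; rewrite ej; lra.
have sn : s (size l) = stop a by rewrite /s nth_default.
exists (size l), s; split=> //.
- move=> i il; have [e|ne] := eqVneq i.+1 (size l).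
    by rewrite e sn; have [/andP[]] := sin _ il.
  by apply: slt; rewrite ltn_neqAle ne il.
- move=> i; rewrite leq_eqVlt => /orP[/eqP ->|il]; first by rewrite sn.
  by have [] := sin _ il.
- move=> i t il /andP[t1 t2] bt.
  have tl : t \in l.
    apply/lE; split=> //; have [/andP[h1 h2] _] := sin _ il.
    have h3 : s i.+1 <= stop a.
      have [e|ne] := eqVneq i.+1 (size l); first by rewrite e sn.
      by have [/andP[_ /ltW]] := sin i.+1 ltac:(by rewrite ltn_neqAle ne il).
    by lra.
  have [j jn ej] := idx _ tl; subst t.
  have [ij|ji|e] := ltngtP i j.
  - move: ij; rewrite leq_eqVlt => /orP[/eqP e|ij].
      by move: t2; rewrite e ltxx.
    by have := mono _ _ ij jn; lra.
  - by have := mono _ _ ji il; lra.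
  - by move: t1; rewrite e ltxx.
Qed.

Lemma folds_edge f P v t : folds f P v -> boundary (f t) ->
  exists e : plane * plane, tess_edge e.1 e.2 /\ segment e.1 e.2 (P + t *: v).
Proof.
case=> _ _ /(_ t)[tf [w hw e]] [j sj].
have [w' [hw' k1 k2]] := weyl_inv hw; have mw' := weyl_motion hw'.
exists (w' (vertex (j + 1)), w' (vertex (j + 2%:R))); split=> /=.
  by apply: tess_edge_motion (side_edge R j) => //; exact: weyl_tess.
have -> : P + t *: v = w' (f t) by rewrite e k1.
exact: segment_motion.
Qed.

(** Unfoldings forget everything about an orbit except the pair (P, V). *)
Lemma unfolding_line a P Q : periodic_orbit a -> unfolding a P Q ->
  sector_line P (Q - P) /\ same_orbit a (line_orbit P (Q - P)).
Proof.
move=> pa [a' [n [s [sigma [[sa na] [s0 sn slt sb snb] er eP eQ]]]]].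
have pa' := same_orbit_periodic sa pa.
have [v [gv dv so]] := normalized_sector_line pa' na.
have [hn lt per] := pa'.
suff e : Q - P = (stop a' - start a') *: v.
  by rewrite e eP; split=> //; exact: same_orbit_trans sa so.
have n0 : (0 < n)%N by case: (n) s0 sn => // s0 sn; move: lt; rewrite -s0 -sn ltxx.
have := @unfold_straight (traj a') n s sigma v hn.
rewrite s0 => /(_ dv slt sb snb) H.
have {}H : forall i, (i < n)%N -> forall t, s i <= t <= s i.+1 ->
    compose sigma i (traj a' t) = traj a' (start a') + (t - start a') *: v.
  apply: H => i hi e; have [p [q [h1 h2 h3]]] := er i hi; exists p, q; split=> //.
  by rewrite -e.
have := H n.-1; rewrite prednK // => /(_ (leqnn _) (s n)).
rewrite lexx (ltW (_ : s n.-1 < s n)); last first.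
    by rewrite -{2}(prednK n0); apply: slt; rewrite prednK.
rewrite sn => /(_ isT); have := per 0; rewrite !addr0 => <-.
by rewrite -eP -eQ => ->; rewrite addrAC subrr add0r.
Qed.

(** The reflections are taken in edges that contain the points where the line
    from P to P + V meets the lines of the tessellation. *)
Lemma sector_line_unfolding a P V : periodic_orbit (line_orbit P V) -> sector_line P V ->
  same_orbit a (line_orbit P V) -> finite_set (strike_times (line_orbit P V)) ->
  unfolding a P (P + V).
Proof.
move=> pL gP sa fin; set L := line_orbit P V in pL sa fin *.
have tP := sector_line_triangle gP; have LP := line_orbit_start V tP.
case: (gP) => y0 x01 _ av.
have bL : boundary (traj L (start L)).
  by rewrite LP; exists 0; apply/side0_BC.
have [n [s ss]] := successive_exists pL bL fin.
have [s0 sn slt sb snb] := ss; have [hn lt per] := pL.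
have hf : folds (traj L) P V := fold_folds av.
have [e he] : {e : R -> plane * plane & forall t, boundary (traj L t) ->
    tess_edge (e t).1 (e t).2 /\ segment (e t).1 (e t).2 (P + t *: V)}.
  apply: (@choice _ _ (fun t (e : plane * plane) => boundary (traj L t) ->
    tess_edge e.1 e.2 /\ segment e.1 e.2 (P + t *: V))) => t.
  have [bt|nb] := pselect (boundary (traj L t)); last by exists (P, P).
  by have [e he] := folds_edge hf bt; exists e.
pose sigma i := reflect_line (e (s i)).1 (e (s i)).2.
have n0 : (0 < n)%N by case: (n) s0 sn => // s0 sn; move: lt; rewrite -s0 -sn ltxx.
have dL : departs (traj L) (s 0%N) V by rewrite s0; exact: line_orbit_departs.
have zE t : traj L (s 0%N) + (t - s 0%N) *: V = P + t *: V.
  by rewrite s0 LP /= subr0.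
have H := unfold_straight hn dL slt sb snb (sigma := sigma).
have {}H : forall i, (i < n)%N -> forall t, s i <= t <= s i.+1 ->
    compose sigma i (traj L t) = P + t *: V.
  move=> i hi t ht; rewrite -zE; apply: H => // k /andP[k0 kn] _.
  exists (e (s k)).1, (e (s k)).2; rewrite zE.
  by have [h1 h2] := he (s k) (sb _ (ltnW kn)); split.
exists L, n, s, sigma; split=> //.
- by split=> //; exact: sector_line_normalized.
- move=> i /andP[i0 iN]; exists (e (s i)).1, (e (s i)).2.
  have [h1 h2] := he (s i) (sb _ (ltnW iN)); split=> //.
  rewrite H ?(leq_ltn_trans (leq_pred i)) //.
  by rewrite prednK // lexx andbT ltW // -{2}(prednK i0); apply: slt; rewrite prednK // ltnW.
- have := H n.-1; rewrite prednK // => /(_ (leqnn _) (s n)).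
  rewrite lexx (ltW (_ : s n.-1 < s n)); last first.
    by rewrite -{2}(prednK n0); apply: slt; rewrite prednK.
  rewrite sn => /(_ isT); have := per 0; rewrite !addr0 => <-.
  by rewrite LP /= scale1r => ->.
Qed.

End Unfolding.

(** * Equivalence classes *)

Section Classes.
Variable R : realType.
Local Notation plane := (plane R).
Implicit Types (p q r u v d P Q V : plane) (h w g : plane -> plane)
  (f : R -> plane) (t : R) (a b : billiard_orbit R).

Lemma boundary_relabel (sg : {perm 'I_3}) p : boundary (relabel sg p) <-> boundary p.
Proof.
split=> -[i /sideP[tp bp]].
  exists (sg^-1%g i); apply/sideP; split; first by apply/(relabel_triangle sg).
  by rewrite -(bary_relabel sg) permKV.
by exists (sg i); apply/sideP; rewrite bary_relabel bp; split=> //; apply/relabel_triangle.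
Qed.

Lemma periodic_shift_int a (k : int) t : periodic_orbit a ->
  traj a (t - (stop a - start a) * k%:~R) = traj a t.
Proof.
move=> pa; have [sp sm] := periodic_shift pa.
have H (n : nat) : traj a (t - (stop a - start a) * n%:R) = traj a t /\
    traj a (t + (stop a - start a) * n%:R) = traj a t.
  elim: n => [|n [IH1 IH2]]; first by rewrite mulr0 subr0 addr0.
  split; [rewrite -IH1 -[RHS]sm|rewrite -IH2 -[RHS]sp]; congr (traj a _);
    rewrite -natr1; lra.
by case: k => n; [exact: (H n).1|rewrite NegzE intrN mulrN opprK; exact: (H n.+1).2].
Qed.

(** The change of time maps a period of b onto a period of a; reducing the result
    modulo the duration of a gives an injection into the chosen period. *)
Lemma strike_times_le a b : periodic_orbit a -> same_orbit a b ->
  (strike_times b #<= strike_times a)%card.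
Proof.
move=> pa [g [c [d [/symmetry_relabel[sg ->] c0 h1 h2]]]].
have [_ lt _] := pa; have T0 : 0 < stop a - start a by lra.
set T := stop a - start a in T0 h2.
have cp : 0 < `|c| by rewrite normr_gt0.
pose k t := Num.floor ((c * t + d - start a) / T).
pose phi t := c * t + d - T * (k t)%:~R.
have inj : {in strike_times b &, injective phi}.
  move=> t t'; rewrite !inE => -[/andP[t1 t2] _] [/andP[t1' t2'] _] e.
  have e' : c * (t - t') = T * (k t - k t')%:~R.
    by move: e; rewrite /phi intrB; lra.
  have : `|T * (k t - k t')%:~R| < T * 1.
    by rewrite -e' normrM mulr1 -h2 ltr_pM2l // ltr_norml; apply/andP; split; lra.
  rewrite normrM (gtr0_norm T0) ltr_pM2l // -intr_norm -[1]/(1%:~R) ltr_int => kk.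
  have k0 : k t - k t' = 0 by lia.
  by move/eqP: e'; rewrite k0 mulr0 mulf_eq0 (negbTE c0) subr_eq0 => /eqP.
rewrite -(card_le_eql (inj_card_eq inj)); apply: subset_card_le => _ [t [tb bt] <-].
split.
  have /andP[f1 f2] := floor_itv ((c * t + d - start a) / T).
  move: f1 f2; rewrite -/(k t) ler_pdivlMr // ltr_pdivrMr // intrD => f1 f2.
  by rewrite /phi /T in f1 f2 *; apply/andP; split; lra.
by rewrite /phi periodic_shift_int //; move: bt; rewrite h1 boundary_relabel.
Qed.

Lemma has_period_same a b n : periodic_orbit a -> same_orbit a b ->
  has_period a n -> has_period b n.
Proof.
move=> pa sa; apply: card_eq_trans; apply: Cantor_Bernstein; first exact: strike_times_le.
by apply: strike_times_le; [exact: same_orbit_periodic pa|exact: same_orbit_sym].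
Qed.

Lemma even_vector_has_period P V : sector_line P V -> even_vector V ->
  exists n, has_period (line_orbit P V) (2 * n) /\ rx V + ry V = n%:R.
Proof.
move=> gP [x [y [ex ey _]]]; exists (x + y)%N; split; first exact: even_count.
by rewrite ex ey natrD.
Qed.

Lemma even_vector_periodic P V : avoids P V -> even_vector V ->
  periodic_orbit (line_orbit P V).
Proof.
move=> av [x [y [ex ey [k ek]]]]; apply/line_orbit_periodic => //.
have [w hw E] := weyl_translation R x k.
have wE p : w p = p + V.
  apply: rxy_inj; rewrite E ?(rx_rhombic, ry_rhombic) !rxyE ?ex ?ey //.
  by rewrite -ek.
exists w => //; split; first by rewrite wE.
by rewrite /lin !wE add0r addrK.
Qed.

Lemma has_period_line_cases P V n : sector_line P V -> periodic_orbit (line_orbit P V) ->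
  has_period (line_orbit P V) n ->
  (even_vector V /\ exists2 m, n = (2 * m)%N & rx V + ry V = m%:R) \/
  [/\ rx P = 1 / 2, rx V = 0 &
    exists2 k : nat, n = (3 * (2 * k + 1))%N & ry V = (3 * (2 * k + 1))%:R / 2].
Proof.
move=> gP pL hn; case: (periodic_line_cases gP pL) => [ev|[p1 x0 [k yV]]].
  left; split=> //; have [m [hm e]] := even_vector_has_period gP ev.
  by exists m => //; exact: card_eq_II_inj hn hm.
right; split=> //; exists k => //; apply: card_eq_II_inj hn _; exact: odd_count.
Qed.

(** The two lines are carried to each other by a relabelling followed by an
    element of the Weyl group; equal durations leave c = 1 or c = -1. *)
Lemma same_line_orbit_motion P V P' V' : sector_line P V ->
  same_orbit (line_orbit P V) (line_orbit P' V') ->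
  sector_line P' V' -> exists h (c d : R),
  [/\ motion h /\ tess_map h, `|c| = 1, P' = h (P + d *: V) & V' = c *: lin h V].
Proof.
move=> gP [g [c [d [/symmetry_relabel[sg ->] c0 h1 h2]]]] gP'.
case: (gP) (gP') => _ _ _ av [_ _ _ av'].
have f1 := folds_same sg d (fold_folds av) c0.
have f2 := fold_folds av'.
have e : (fun t => fold (P' + t *: V')) = (fun t => relabel sg (fold (P + (c * t + d) *: V))).
  by apply/funext => t; have := h1 t.
rewrite e in f2; have [w hw [e1 e2]] := folds_change f1 f2.
have mw := weyl_motion hw; have ms := relabel_motion R sg.
exists (w \o relabel sg), c, d; split=> //.
- split; first exact: motion_comp.
  by move=> r tr /=; apply: weyl_tess => //; exact: relabel_tess.
- by move: h2; rewrite /= !subr0 mulr1.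
- by rewrite e2 (linZ _ _ mw) (lin_comp _ _ mw).
Qed.

(** The period gives rx V + ry V and the length gives a second symmetric function
    of rx V and ry V; together they determine V, as rx V <= ry V. *)
Lemma even_vector_unique P V P' V' : sector_line P V -> sector_line P' V' ->
  periodic_orbit (line_orbit P V) ->
  same_orbit (line_orbit P V) (line_orbit P' V') -> even_vector V -> V' = V.
Proof.
move=> gP gP' pL so ev; have [n [hn en]] := even_vector_has_period gP ev.
have hn' := has_period_same pL so hn.
case: (has_period_line_cases gP' (same_orbit_periodic so pL) hn')
  => [[ev' [m em e']]|[_ _ [k ek _]]];
  last by lia.
have {em} mn : m = n by lia.
subst m.
have [h [c [d [[mh _] c1 _ eV]]]] := same_line_orbit_motion gP so gP'.
have : enorm V' = enorm V by rewrite eV enormZ c1 mul1r enorm_lin.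
move/(congr1 (fun x => x ^+ 2)); rewrite !enorm_sq !dot_rxyE => q.
case: gP gP' => _ _ /andP[x0 xy] _ [_ _ /andP[x0' xy'] _].
have : (ry V' - rx V') ^+ 2 = (ry V - rx V) ^+ 2.
  have : (rx V' + ry V') * (rx V' + ry V') = (rx V + ry V) * (rx V + ry V) by rewrite e' en.
  by rewrite !expr2; lra.
move/eqP; rewrite eqrXn2 ?subr_ge0 // => /eqP dd.
by apply: rxy_inj; lra.
Qed.

(** The functional u |-> ry V * rx u - rx V * ry u is constant along V.  A
    symmetry of the tessellation that maps V to V or -V preserves it up to sign
    and the integer it takes at the image of the origin, since its matrix is
    integral of determinant 1 or -1.  Both starting points are on ry = 0, where
    the functional is ry V * rx. *)
Lemma start_congruence P V P' : sector_line P V -> sector_line P' V -> even_vector V ->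
  same_orbit (line_orbit P V) (line_orbit P' V) ->
  exists m : int, ry V * rx P' = ry V * rx P + m%:~R \/ ry V * rx P' = - (ry V * rx P) + m%:~R.
Proof.
move=> gP gP' [x [y [ex ey _]]] so.
have [h [c [d [[mh th] c1 eP eV]]]] := same_line_orbit_motion gP so gP'.
case: (gP) (gP') => yP _ _ _ [yP' _ _ _].
have tv (a b : int) : tess_vertex (rhombic (0 : plane) a%:~R b%:~R).
  by apply/tess_vertexP; exists a, b; rewrite ?(rx_rhombic, ry_rhombic) ?rxyE ?add0r.
have t0 : tess_vertex (0 : plane) by apply/tess_vertexP; exists 0, 0; rewrite !rxyE.
have t1 : tess_vertex (e1 : plane) by apply/tess_vertexP; exists 1, 0; rewrite !rxyE.
have t2 : tess_vertex (e2 : plane) by apply/tess_vertexP; exists 0, 1; rewrite !rxyE.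
have /tess_vertexP[m0 [n0 [em en]]] := th _ t0.
have /tess_vertexP[m1 [n1 [em1 en1]]] := th _ t1.
have /tess_vertexP[m2 [n2 [em2 en2]]] := th _ t2.
have a1 : rx (lin h e1) = (m1 - m0)%:~R by rewrite /lin rxD rxN em1 em intrB.
have b1 : ry (lin h e1) = (n1 - n0)%:~R by rewrite /lin ryD ryN en1 en intrB.
have a2 : rx (lin h e2) = (m2 - m0)%:~R by rewrite /lin rxD rxN em2 em intrB.
have b2 : ry (lin h e2) = (n2 - n0)%:~R by rewrite /lin ryD ryN en2 en intrB.
(* The linear part has the matrix with rows (A, B) and (C, D). *)
move: (m1 - m0) (n1 - n0) (m2 - m0) (n2 - n0) a1 b1 a2 b2 {em1 en1 em2 en2 t0 t1 t2}
  => A C B D a1 b1 a2 b2.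
have Vd : V = x%:R *: e1 + y%:R *: e2 by apply: rxy_inj; rewrite !rxyE ?ex ?ey; lra.
have Pd : P = rx P *: e1 by apply: rxy_inj; rewrite !rxyE ?yP; lra.
have lV : lin h V = x%:R *: lin h e1 + y%:R *: lin h e2.
  by rewrite {1}Vd (linD _ _ mh) !(linZ _ _ mh).
have g1 := mh.2 e1 e1; have g2 := mh.2 e2 e2; have g3 := mh.2 e1 e2.
have cc : c * c = 1.
  by have := congr1 (fun z => z ^+ 2) c1; rewrite -normrX ger0_norm ?sqr_ge0 // expr1n expr2.
have v1 : x%:R = c * (x%:R * A%:~R + y%:R * B%:~R) :> R.
  by rewrite -[LHS]ex [in LHS]eV lV rxZ rxD !rxZ a1 a2.
have v2 : y%:R = c * (x%:R * C%:~R + y%:R * D%:~R) :> R.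
  by rewrite -[LHS]ey [in LHS]eV lV ryZ ryD !ryZ b1 b2.
have hP : h (P + d *: V) = h 0 + (rx P *: lin h e1 + d *: lin h V).
  rewrite (mh.1 P) {1}Pd -{1}[rx P *: e1]add0r (mh.1 0); by rewrite addrA.
have lc : lin h V = c *: V by rewrite [V in RHS]eV scalerA cc scale1r.
have r1 : rx P' = m0%:~R + (rx P * A%:~R + d * (c * x%:R)).
  by rewrite eP hP lc rxD rxD !rxZ em a1 ex.
have r2 : 0 = n0%:~R + (rx P * C%:~R + d * (c * y%:R)) :> R.
  by rewrite -yP' eP hP lc ryD ryD !ryZ en b1 ey.
move: g1 g2 g3; rewrite !dot_rxyE a1 b1 a2 b2 !rxyE => g1 g2 g3.
set det : R := A%:~R * D%:~R - B%:~R * C%:~R.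
(* Comparing the Gram determinants of (e1, e2) and of its image. *)
have d2 : det * det = 1.
  have := congr2 (fun z z' : R => z * z') g1 g2.
  have := congr2 (fun z z' : R => z * z') g3 g3; rewrite /det.
  move: (A%:~R) (B%:~R) (C%:~R) (D%:~R) => A1 B1 C1 D1 k1 k2; nra.
have key : y%:R * A%:~R - x%:R * C%:~R = c * det * y%:R.
  rewrite /det; move: v1 v2 cc; move: (A%:~R) (B%:~R) (C%:~R) (D%:~R) (x%:R) (y%:R)
    => A1 B1 C1 D1 x1 y1 v1' v2' _.
  transitivity ((c * (x1 * C1 + y1 * D1)) * A1 - (c * (x1 * A1 + y1 * B1)) * C1).
    by rewrite -v1' -v2'.
  by ring.
have fin : y%:R * rx P' = y%:R * m0%:~R - x%:R * n0%:~R + (c * det) * (y%:R * rx P).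
  have := congr1 (fun z : R => x%:R * z) r2; rewrite r1 mulr0 => k.
  have : (y%:R * A%:~R - x%:R * C%:~R) * rx P = c * det * y%:R * rx P by rewrite key.
  by lra.
rewrite ey; exists (y%:Z * m0 - x%:Z * n0).
have cd : (c * det) * (c * det) = 1 by rewrite mulrACA cc d2 mulr1.
have : (c * det - 1) * (c * det + 1) = 0 by lra.
rewrite intrB !intrM; move/eqP; rewrite mulf_eq0 => /orP[]/eqP k.
  by left; rewrite fin (_ : c * det = 1); last lra; lra.
by right; rewrite fin (_ : c * det = -1); last lra; lra.
Qed.

Lemma unfolding_same_vector a P V Q S : periodic_orbit a -> sector_line P V -> even_vector V ->
  same_orbit a (line_orbit P V) -> unfolding a Q S -> S - Q = V.
Proof.
move=> pa gP ev sa uQ; have [gQ sQ] := unfolding_line pa uQ.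
apply: (even_vector_unique gP gQ) => //; first exact: same_orbit_periodic sa pa.
exact: same_orbit_trans (same_orbit_sym sa) sQ.
Qed.

Lemma even_unfolding a P V : sector_line P V -> even_vector V -> same_orbit a (line_orbit P V) ->
  unfolding a P (P + V).
Proof.
move=> gP ev sa; apply: sector_line_unfolding => //.
  by apply: even_vector_periodic => //; case: gP.
by have [n [hn _]] := even_vector_has_period gP ev; exists (2 * n)%N.
Qed.

Section EvenClass.
Variables (a : billiard_orbit R) (P V : plane).
Hypotheses (pa : periodic_orbit a) (gP : sector_line P V) (ev : even_vector V)
  (sa : same_orbit a (line_orbit P V)).

Lemma eq_class_line Q : sector_line Q V -> eq_class a (line_orbit Q V).
Proof.
move=> gQ; split; first by apply: even_vector_periodic => //; case: gQ.
exists P, (P + V), Q, (Q + V); split.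
- exact: even_unfolding.
- by apply: even_unfolding => //; exact: same_orbit_refl.
- exists (rx Q - rx P); case: gP gQ => y0 _ _ _ [y0' _ _ _].
  by split; apply: rxy_inj; rewrite !rxyE ?y0 ?y0'; lra.
Qed.

Lemma eq_class_sector_line b : eq_class a b ->
  exists2 Q, sector_line Q V & same_orbit b (line_orbit Q V).
Proof.
case=> pb [P1 [Q1 [R1 [S1 [u1 u2 [x [eR eS]]]]]]].
have e1 := unfolding_same_vector pa gP ev sa u1.
have e2 : S1 - R1 = V by rewrite eR eS -e1 opprD addrACA subrr addr0.
by have [g s] := unfolding_line pb u2; rewrite e2 in g s; exists R1.
Qed.

Lemma same_class_eq b b' : periodic_orbit b -> same_orbit b b' -> same_class b = same_class b'.
Proof.
move=> pb s; apply/seteqP; split=> c [pc sc]; split=> //.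
  exact: same_orbit_trans (same_orbit_sym s) sc.
exact: same_orbit_trans s sc.
Qed.

(** If the line through (x, 0) in direction V met a vertex, ry V * x would be an
    integer. *)
Lemma short_sector_line (x : R) : 0 < x -> ry V * x < 1 / 2 -> sector_line (rhombic 0 x 0) V.
Proof.
move=> x0 xs; have y0 := sector_line_ry_gt0 gP; case: gP => _ _ sec [v0 _].
case: ev => m [n [em en _]].
have n1 : 1 <= ry V by rewrite en ler1n -(ltr0n R) -en.
split=> //; rewrite ?(rx_rhombic, ry_rhombic) ?rxyE //.
- by lra.
- by apply/andP; split; nra.
split=> // t /tess_vertexP[k [l [ek el]]].
move: ek el; rewrite !rxyE ?(rx_rhombic, ry_rhombic) ?rxyE em en => ek el.
have e : n%:R * x = (n%:Z * k - m%:Z * l)%:~R.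
  by rewrite intrB !intrM -ek -el -[(Posz n)%:~R]/(n%:R) -[(Posz m)%:~R]/(m%:R); lra.
have h1 : 0 < n%:R * x by rewrite mulr_gt0 // -en.
have h2 : n%:R * x < 1 by rewrite -en; lra.
have i1 : 0 < n%:Z * k - m%:Z * l by rewrite -(ltr_int R) -e.
have i2 : n%:Z * k - m%:Z * l < 1 by rewrite -(ltr_int R) -e.
by lia.
Qed.

(** At most: a member of the class is determined by the point of BC where it
    starts.  At least: for starting points with 1/8 <= ry V * x <= 1/4 neither
    the sum nor the difference of two distinct values of ry V * x is an integer,
    so the orbits are pairwise different. *)
Lemma even_class_card : (eq_class_mod_same a #= [set` `[(0 : R), 1]])%card.
Proof.
have y0 := sector_line_ry_gt0 gP.
pose G (x : R) := same_class (line_orbit (rhombic 0 x 0) V).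
apply: Cantor_Bernstein.
  apply: (@card_le_trans _ _ _ (G @` [set` `[(0 : R), 1]])); last exact: card_image_le.
  apply: subset_card_le => _ [b cb <-]; have [Q gQ s] := eq_class_sector_line cb.
  case: (gQ) => yQ xQ _ _; exists (rx Q); first by rewrite /= in_itv.
  have -> : G (rx Q) = same_class (line_orbit Q V).
    rewrite /G; congr (same_class (line_orbit _ V)).
    by apply: rxy_inj; rewrite ?(rx_rhombic, ry_rhombic) ?rxyE ?yQ; lra.
  by apply/esym/same_class_eq => //; case: cb.
(* As t runs over [0, 1], ry V * X t runs over [1/8, 1/4]. *)
pose X t : R := (1 + t) / (8 * ry V).
have yX t : ry V * X t = (1 + t) / 8 by rewrite /X; field; rewrite gt_eqF.
have gX t : 0 <= t <= 1 -> sector_line (rhombic 0 (X t) 0) V.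
  move=> /andP[t0 t1]; apply: short_sector_line; last by rewrite yX; lra.
  by rewrite /X divr_gt0 //; [lra|rewrite mulr_gt0].
have inj : {in [set` `[(0 : R), 1]] &, injective (G \o X)}.
  move=> t t'; rewrite !inE /= !in_itv /= => ht ht' /= e.
  have : same_class (line_orbit (rhombic 0 (X t) 0) V) (line_orbit (rhombic 0 (X t') 0) V).
    rewrite -/(G (X t)) e; split; last exact: same_orbit_refl.
    by apply: even_vector_periodic => //; case: (gX _ ht').
  case=> _ /(start_congruence (gX _ ht) (gX _ ht') ev)[m].
  rewrite !rx_rhombic rx0 !add0r !yX => H.
  have [h1 h2] : -1 < m /\ m < 1.
    by rewrite -!(ltr_int R); case: H => h; split; lra.
  have m0 : m = 0 by lia.
  by move: H; rewrite m0 => -[]; lra.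
rewrite -(card_le_eql (inj_card_eq inj)); apply: subset_card_le => _ [t + <-].
rewrite /= in_itv /= => ht; exists (line_orbit (rhombic 0 (X t) 0) V) => //.
by apply: eq_class_line; exact: gX.
Qed.

(** V is a lattice vector, so if the line through O met a vertex, so would the
    segment from O to O + V. *)
Lemma nonsingular_sector_line (O : plane) : segment ptB ptC O ->
  ~ singular_point a O -> sector_line O V.
Proof.
move=> /segment_BC[yO xO] ns; case: (gP) => _ _ sec [v0 _]; split=> //; split=> // t tv.
apply: ns; exists a, P, (P + V); split.
- split=> //; exists P, (P + V), P, (P + V).
  have uP := even_unfolding gP ev sa; split=> //.
  by exists 0; rewrite scale0r !addr0.
- exact: even_unfolding.
- exact/segment_BC.
case: ev => m [n [em en _]].
set k := Num.floor t; have /andP[f1 f2] := floor_itv t.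
exists (O + (t - k%:~R) *: V).
  move: tv => /tess_vertexP[i [j [ei ej]]]; apply/tess_vertexP.
  exists (i - k * m), (j - k * n); rewrite !rxD !rxZ !ryD !ryZ in ei ej *.
  rewrite !intrB !intrM -ei -ej em en -[(Posz n)%:~R]/(n%:R) -[(Posz m)%:~R]/(m%:R); split; lra.
apply/segmentP; exists (t - k%:~R).
  by move: f1 f2; rewrite intrD -/k => f1 f2; apply/andP; split; lra.
congr (_ + _ *: _); by apply: rxy_inj; rewrite !rxyE; lra.
Qed.

End EvenClass.
End Classes.

Theorem theorem4 (R : realType) (alpha gamma : billiard_orbit R) (O : plane R)
  (halpha : periodic_orbit alpha)
  (hgamma : fagnano gamma)
  (hO : segment ptB ptC O)
  (hOmid : O <> midpoint ptB ptC)
  (hOns : forall beta : billiard_orbit R,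
      periodic_orbit beta -> even_period beta -> ~ singular_point beta O) :
  (forall n : nat, has_period alpha (2 * n)%N ->
     (eq_class_mod_same alpha #= [set` `[(0 : R), 1]])%card /\
     (exists beta : billiard_orbit R,
        [/\ eq_class alpha beta, standard_representative O n beta &
            forall beta' : billiard_orbit R,
              eq_class alpha beta' -> standard_representative O n beta' ->
              same_orbit beta beta'])) /\
  (~ even_period alpha ->
     exists k : nat,
       [/\ (1 <= k)%N, same_orbit alpha (iterate gamma (2 * k - 1)) &
           has_period alpha (6 * k - 3)]).
Proof.
have [P [V [gP sa]]] := normalize halpha.
have pL := same_orbit_periodic sa halpha.
split=> [n hn|nev].
  have hL := has_period_same halpha sa hn.
  case: (has_period_line_cases gP pL hL) => [[ev [m mn em]]|[_ _ [k ek _]]]; last by lia.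
  have {mn} mn : m = n by lia.
  subst m; split; first exact: even_class_card halpha gP ev sa.
  have gO : sector_line O V.
    by apply: (nonsingular_sector_line halpha gP ev sa hO); apply: hOns => //; exists n.
  have cO := eq_class_line gP ev sa gO.
  exists (line_orbit O V); split=> //.
    case: (ev) => x [y [ex ey [k ek]]].
    exists (O + V), x, y; split.
    - by apply: even_unfolding => //; exact: same_orbit_refl.
    - by apply: rxy_inj; rewrite ?(rx_rhombic, ry_rhombic) !rxyE ?ex ?ey.
    - case: gP => _ _ + _; rewrite ex ey ler0n ler_nat => xy.
      by rewrite !lez_nat.
    - by rewrite ek addrC mulrC modzMDl.
    - apply: (@intr_inj R); rewrite intrD; move: em; rewrite ex ey => em. exact: em.
  move=> b cb [S [x [y [uS _ _ _ _]]]].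
  have [Q gQ sQ] := eq_class_sector_line halpha gP ev sa cb.
  have pb : periodic_orbit b by case: cb.
  have eV := unfolding_same_vector pb gQ ev sQ uS.
  have [_] := unfolding_line pb uS; rewrite eV; exact: same_orbit_sym.
have [[pgam _] g3 _] := hgamma.
have [P' [V' [gP' sg]]] := normalize pgam.
have pL' := same_orbit_periodic sg pgam.
have h3 := has_period_same pgam sg g3.
case: (has_period_line_cases gP' pL' h3) => [[_ [m mn _]]|[xP' xV' [k' ek' yV']]]; first by lia.
have {ek'} k0 : k' = 0%N by lia.
subst k'.
case: (periodic_line_cases gP pL) => [ev|[xP xV [k yV]]].
  have [n [hn _]] := even_vector_has_period gP ev.
  by case: nev; exists n; apply: has_period_same hn => //; exact: same_orbit_sym.
have eP : P' = P by apply: rxy_inj; [rewrite xP xP'|case: gP gP' => -> _ _ _ [-> _ _ _]].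
have hk := odd_count gP xP xV yV.
exists k.+1; split=> //; last first.
  have -> : (6 * k.+1 - 3 = 3 * (2 * k + 1))%N by lia.
  by apply: has_period_same hk => //; exact: same_orbit_sym.
have -> : (2 * k.+1 - 1 = 2 * k + 1)%N by lia.
set m := (2 * k + 1)%N.
have m0 : 0 < m%:R :> R by rewrite ltr0n /m; lia.
apply: same_orbit_trans sa _.
apply: same_orbit_trans (same_orbit_sym (same_orbit_iterate m sg)).
have eV : V = m%:R *: V'.
  by apply: rxy_inj; rewrite !rxyE ?xV ?xV' ?yV ?yV' ?mulr0 // -/m !natrM natrD !natrM; lra.
exists (relabel 1%g), (m%:R^-1), 0; split.
- exact: relabel_symmetry.
- by rewrite invr_eq0 gt_eqF.
- move=> t; rewrite relabel1 /= eP eV addr0 scalerA; congr (fold (_ + _ *: _)).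
  by field; rewrite gt_eqF.
- by rewrite /= !subr0 add0r mulr1 gtr0_norm ?invr_gt0 // mulVf // gt_eqF.
Qed.
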